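(* Let $1\le d\le D$ and $n\ge 1$ be integers and $m_0\in\mathbb{N}$. Let $\mathcal{C}\subseteq \mathcal{C}([0,1]^d,\mathbb{R})$ be the constraint set induced by $\mathcal{C}_D\subseteq\mathcal{C}([0,1]^D,\mathbb{R})$, let $\overset{\bullet}{\mathcal{C}}\subseteq\mathcal{C}$ be a chosen subset, let $k$ be the covariance function on $[0,1]^d\times[0,1]^d$ with RKHS $\mathcal{H}$, let $X=(x^{(1)},\dots,x^{(n)})\in([0,1]^d)^n$ and $y^{(n)}=(y_1,\dots,y_n)\in\mathbb{R}^n$ (see context for all notation). Let $(S^{(m)})_{m\ge m_0}$ be a sequence of $d$-dimensional subdivisions that is nested, i.e. $S^{(m)}_i\subseteq S^{(m+1)}_i$ for all $i\in\{1,\dots,d\}$ and $m\ge m_0$. Let $$F=F_1\times\dots\times F_d,\qquad F_i=[0,1]\cap\overline{\bigcup_{m\ge m_0}S^{(m)}_i}.$$ Assume: (1) $\mathcal{C}_D$ is convex and closed for the topology of uniform convergence. (2) The set $\{\alpha\in A_{S^{(m_0)}}:\ Y_{S^{(m_0)},\alpha}\in\mathcal{I}_{X,y^{(n)}}\cap\overset{\bullet}{\mathcal{C}}\}$ is non-empty. (3) $\{(Y_{S^{(m_0)},\alpha}(x^{(i)}))_{i=1,\dots,n}:\ \alpha\in A_{S^{(m_0)}}\}=\mathbb{R}^n$. (4) For all $h\in\overset{\bullet}{\mathcal{C}}$, all $r\in\mathbb{N}$ and all pairwise distinct $u_1,\dots,u_r\in[0,1]^d$, with $U=(u_1,\dots,u_r)$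 and $v^{(r)}=(h(u_1),\dots,h(u_r))$, the set $\mathrm{int}_{\|\cdot\|_{\mathcal{H}}}(\mathcal{H}\cap\mathcal{C})\cap\mathcal{I}_{U,v^{(r)}}$ is non-empty. (5) For every $d$-dimensional subdivision $S$, $\pi_S(\mathcal{C})\subseteq\mathcal{C}$. (6) For every $f\in\mathcal{C}$, $P_{F\to[0,1]^d}(f_{|F})\in\mathcal{C}$. Then, as $m\to\infty$, the function $\widehat{Y}_{S^{(m)}}$ converges uniformly on $[0,1]^d$ to $P_{F\to[0,1]^d}(Y_{F,\mathrm{opt}})$, where $$Y_{F,\mathrm{opt}}=\underset{f\in\mathcal{H}_F\cap\mathcal{C}_F\cap\mathcal{I}_{F,X,y^{(n)}}}{\mathrm{argmin}}\ \|f\|_{\mathcal{H}_F}.$$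
   Context: For a subset $A$ of a finite-dimensional vector space, $\mathcal{C}(A,\mathbb{R})$ is the set of continuous functions $A\to\mathbb{R}$. Constraint set: given $\mathcal{C}_D\subseteq\mathcal{C}([0,1]^D,\mathbb{R})$, $\mathcal{C}$ is the set of $g:[0,1]^d\to\mathbb{R}$ such that the function $x\in[0,1]^D\mapsto g(x_1,\dots,x_d)$ belongs to $\mathcal{C}_D$. The set $\overset{\bullet}{\mathcal{C}}\subseteq\mathcal{C}$ is a freely chosen subset (interpreted as functions satisfying the constraints strictly). Kernel: $k_D$ is the continuous covariance function on $[0,1]^D\times[0,1]^D$ of a centered Gaussian process with continuous trajectories, and $k(u,v)=k_D(\widetilde u,\widetilde v)$ for $u,v\in[0,1]^d$, where $\widetilde u=(u,0,\dots,0)$, $\widetilde v=(v,0,\dots,0)\in[0,1]^D$. $\mathcal{H}$ is the RKHS of $k$; $\mathrm{int}_{\|\cdot\|_{\mathcal H}}(\mathcal{H}\cap\mathcal{C})$ is the interior in $\mathcal{H}$ for the RKHS norm. Subdivisions: a one-dimensional subdivision is a finite set $S\subset\mathbb{R}$ with ordered elements $-1=t^{(S)}_{(0)}<0=t^{(S)}_{(1)}<\dots<t^{(S)}_{(m_S)}=1<t^{(S)}_{(m_S+1)}=2$. A $d$-dimensional subdivision is a vector $S=(S_1,\dots,S_d)$ of one-dimensional subdivisions. Put $\mathcal{L}_S=\prod_{i=1}^d\{1,\dots,m_{S_i}\}$, $A_S=\mathbb{R}^{\mathcal{L}_S}$, and for $\underline{\ell}=(\ell_1,\dots,\ell_d)\in\mathcal{L}_S$,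 $t^{(S)}_{\underline\ell}=(t^{(S_1)}_{(\ell_1)},\dots,t^{(S_d)}_{(\ell_d)})$. Basis functions: for $u<v<w$, $\phi_{u,v,w}(t)=\frac{t-u}{v-u}$ for $u\le t\le v$, $\frac{w-t}{w-v}$ for $v\le t\le w$, and $0$ otherwise; $\phi^{(S)}_{\underline\ell}(t)=\prod_{i=1}^d\phi_{t^{(S_i)}_{(\ell_i-1)},t^{(S_i)}_{(\ell_i)},t^{(S_i)}_{(\ell_i+1)}}(t_i)$ for $t\in[0,1]^d$. For $\alpha\in A_S$, $Y_{S,\alpha}=\sum_{\underline\ell\in\mathcal{L}_S}\alpha_{\underline\ell}\phi^{(S)}_{\underline\ell}$; for $f:[0,1]^d\to\mathbb{R}$, $\pi_S(f)=\sum_{\underline\ell\in\mathcal{L}_S}f(t^{(S)}_{\underline\ell})\phi^{(S)}_{\underline\ell}$. Interpolation set: for $U=(u_1,\dots,u_r)\in([0,1]^d)^r$ and $v^{(r)}\in\mathbb{R}^r$, $\mathcal{I}_{U,v^{(r)}}=\{f:[0,1]^d\to\mathbb{R}:\ f(u_i)=v_i,\ i=1,\dots,r\}$. Mode: $k(S,S)=[k(t^{(S)}_{\underline\ell},t^{(S)}_{\underline\ell'})]_{\underline\ell,\underline\ell'\in\mathcal{L}_S}$, which is assumed invertible for every $d$-dimensional subdivision $S$; $\widehat\alpha_S=\mathrm{argmin}\{\alpha^\top k(S,S)^{-1}\alpha:\ \alpha\in A_S,\ Y_{S,\alpha}\in\mathcal{I}_{X,y^{(n)}}\cap\mathcal{C}\}$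 and $\widehat{Y}_S=Y_{S,\widehat\alpha_S}$. Multiaffine extension: let $F=F_1\times\dots\times F_d$ with each $F_i\subseteq[0,1]$ closed and containing $0$ and $1$. For $f\in\mathcal{C}(F,\mathbb{R})$, $P_{F\to[0,1]^d}(f)$ is the unique continuous $g:[0,1]^d\to\mathbb{R}$ equal to $f$ on $F$ and such that for all $i$ and all fixed values of the other coordinates, the function of the $i$-th coordinate $u_i\mapsto g(u_i,t_{\sim i})$ is affine on each interval contained in $[0,1]\setminus F_i$. Restricted objects: $\mathcal{C}_F=\{f\in\mathcal{C}(F,\mathbb{R}): P_{F\to[0,1]^d}f\in\mathcal{C}\}$, $\mathcal{I}_{F,X,y^{(n)}}=\{f\in\mathcal{C}(F,\mathbb{R}): P_{F\to[0,1]^d}f\in\mathcal{I}_{X,y^{(n)}}\}$; $\mathcal{H}_F$ is the RKHS of the restriction of $k$ to $F\times F$, i.e. $\mathcal{H}_F=\{h_{|F}:h\in\mathcal{H}\}$ with $\|f\|_{\mathcal{H}_F}=\inf_{h\in\mathcal{H},\,h_{|F}=f}\|h\|_{\mathcal{H}}$. *)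

(* Defs.v *)
From HB Require Import structures.
From mathcomp Require Import all_boot all_order all_algebra.
From mathcomp Require Import sesquilinear.
From mathcomp Require Import all_classical all_reals all_analysis.
Import Order.TTheory GRing.Theory Num.Theory.
Import numFieldNormedType.Exports.

Local Open Scope classical_set_scope.
Local Open Scope ring_scope.

Definition argmin {R : realType} {T : Type} (A : set T) (J : T -> R) : set T :=
  [set x | A x /\ forall z, A z -> J x <= J z].

(** The cube [0,1]^d. Its elements, and those of its subsets, are used through
    the coercion from sets to types, which carries the subspace topology: a
    function on [0,1]^d is a term of type [cube R d -> R]. *)
Definition cube (R : realType) (d : nat) : set 'rV[R]_d :=
  [set x | forall i, 0 <= x ord0 i <= 1].

Definition coord {R : realType} {d : nat} (x : cube R d) (i : 'I_d) : R :=
  (val x : 'rV[R]_d) ord0 i.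

Lemma coord_itv {R : realType} {d : nat} (x : cube R d) (i : 'I_d) :
  0 <= coord x i <= 1.
Proof. exact: (set_mem (valP x)). Qed.

Lemma mkcube_subproof {R : realType} {d : nat} {c : 'I_d -> R}
    (hc : forall i, 0 <= c i <= 1) :
  \row_i c i \in cube R d.
Proof. by apply: mem_set => i; rewrite mxE. Qed.

Definition mkcube {R : realType} {d : nat} {c : 'I_d -> R}
    (hc : forall i, 0 <= c i <= 1) : cube R d :=
  exist _ (\row_i c i) (mkcube_subproof hc).

Section PaddingAndConstraints.
Context {R : realType} {d D : nat}.

Definition pad_coord (u : cube R d) (j : 'I_D) : R :=
  if insub (val j) is Some i then coord u i else 0.

Lemma pad_coord_itv (u : cube R d) (j : 'I_D) : 0 <= pad_coord u j <= 1.
Proof.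
rewrite /pad_coord; case: insubP => [i _ _|_]; first exact: coord_itv.
by rewrite lexx ler01.
Qed.

Definition pad (u : cube R d) : cube R D := mkcube (pad_coord_itv u).

Definition padded_kernel (kD : cube R D -> cube R D -> R) (u v : cube R d) : R :=
  kD (pad u) (pad v).

Definition head_coords (dD : (d <= D)%N) (x : cube R D) : cube R d :=
  mkcube (fun i : 'I_d => coord_itv x (widen_ord dD i)).

Definition constraint_set (dD : (d <= D)%N) (CD : set (cube R D -> R)) :
    set (cube R d -> R) :=
  [set g : cube R d -> R | CD (g \o head_coords dD)].

End PaddingAndConstraints.

(** Gaussian laws include the degenerate ones (Dirac masses), which
    [normal_prob m s] does not give at [s = 0]. *)
Definition gaussian_law {R : realType}
    (mu : set (measurableTypeR R) -> \bar R) : Prop :=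
  exists m s : R, forall A : set (measurableTypeR R), measurable A ->
    mu A = if s == 0 then \d_m A else normal_prob m s A.

Definition gaussian_process {R : realType} {dsp : measure_display}
    {Omega : measurableType dsp} {P : probability Omega R} {T : Type}
    (Z : T -> {RV P >-> R}) : Prop :=
  forall (r : nat) (x : 'I_r -> T) (a : 'I_r -> R),
    gaussian_law (pushforward P (fun w => \sum_(i < r) a i * Z (x i) w)).

Definition continuous_gp_covariance {R : realType} {T : topologicalType}
    (K : T -> T -> R) : Prop :=
  continuous (fun p : T * T => K p.1 p.2) /\
  exists (dsp : measure_display) (Omega : measurableType dsp)
      (P : probability Omega R) (Z : T -> {RV P >-> R}),
    [/\ gaussian_process Z,
        forall x, ('E_P[Z x] = 0)%E,
        forall x y, covariance P (Z x) (Z y) = (K x y)%:E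
      & forall w, continuous (fun x => Z x w)].

(** The reproducing kernel Hilbert space of [K]: a Hilbert space whose elements
    are identified, through the injective linear map [rkhs_fun], with functions
    on [T]. It is unique up to an isometry commuting with [rkhs_fun]. *)
Record rkhs {R : realType} {T : Type} (K : T -> T -> R) := Rkhs {
  rkhs_space :> completeNormedModType R;
  rkhs_dot : {dot rkhs_space for idfun};
  rkhs_fun : {linear rkhs_space -> (T -> R^o)};
  rkhs_section : T -> rkhs_space;
  rkhs_norm_dot : forall h : rkhs_space, `|h| ^+ 2 = rkhs_dot h h;
  rkhs_fun_inj : injective rkhs_fun;
  rkhs_sectionE : forall x z : T, rkhs_fun (rkhs_section x) z = K x z;
  rkhs_reproducing : forall (h : rkhs_space) (x : T),
    rkhs_fun h x = rkhs_dot h (rkhs_section x)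
}.
Arguments rkhs_fun {R T K} H : rename.
Arguments rkhs_dot {R T K} H : rename.
Arguments rkhs_section {R T K} H x : rename.

Section Subdivisions.
Context {R : realType}.

Record subdivision : Type := Subdivision {
  sub_size : nat;
  sub_nodes : sub_size.+2.-tuple R;
  sub_sorted : sorted <%R sub_nodes;
  sub_node0 : nth 0 sub_nodes 0 = -1;
  sub_node1 : nth 0 sub_nodes 1 = 0;
  sub_node_size : nth 0 sub_nodes sub_size = 1;
  sub_node_last : nth 0 sub_nodes sub_size.+1 = 2
}.

Definition sub_node (s : subdivision) (j : nat) : R := nth 0 (sub_nodes s) j.

Definition sub_set (s : subdivision) : set R := [set` (sub_nodes s : seq R)].

Lemma sub_node_itv (s : subdivision) (j : 'I_(sub_size s)) :
  0 <= sub_node s j.+1 <= 1.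
Proof.
have le_nth (a b : nat) : (a <= b)%N -> (b < (sub_size s).+2)%N ->
    sub_node s a <= sub_node s b.
  move=> ab hb; have := sub_sorted s; rewrite lt_sorted_uniq_le => /andP[_ ss].
  by apply: (sorted_leq_nth le_trans le_refl) => //;
    rewrite inE size_tuple // (leq_ltn_trans ab).
have jm := ltn_ord j.
rewrite -[X in X <= _ <= _](sub_node1 s) -[X in _ <= _ <= X](sub_node_size s).
by rewrite !le_nth// ltnS// ltnW// ltnS ltnW.
Qed.

Definition hat (u v w t : R) : R :=
  if u <= t <= v then (t - u) / (v - u)
  else if v <= t <= w then (w - t) / (w - v)
  else 0.

Section Multivariate.
Context {d : nat}.
Implicit Types S : 'I_d -> subdivision.

(** Multi-indices are shifted by one: [l : lset S] stands for the multi-index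
    with i-th entry [(l i).+1] in {1, ..., m_{S_i}}. *)
Definition lset S := {dffun forall i : 'I_d, 'I_(sub_size (S i))}.

Definition grid_node {S} (l : lset S) : cube R d :=
  mkcube (fun i => sub_node_itv (S i) (l i)).

Definition basis_fun {S} (l : lset S) (t : cube R d) : R :=
  \prod_(i < d) hat (sub_node (S i) (l i)) (sub_node (S i) (l i).+1)
                    (sub_node (S i) (l i).+2) (coord t i).

(** R^{L_S}, with the multi-indices enumerated by [enum_val]. *)
Definition coef_space S : Type := 'cV[R]_#|{: lset S}|.

Definition interp {S} (alpha : coef_space S) (t : cube R d) : R :=
  \sum_(a < #|{: lset S}|) alpha a 0 * basis_fun (enum_val a) t.

Definition sub_proj S (f : cube R d -> R) (t : cube R d) : R :=
  \sum_(l : lset S) f (grid_node l) * basis_fun l t.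

Definition gram (k : cube R d -> cube R d -> R) S : 'M[R]_#|{: lset S}| :=
  \matrix_(a, b) k (grid_node (enum_val a)) (grid_node (enum_val b)).

Definition interpolants {r : nat} (U : 'I_r -> cube R d) (v : 'I_r -> R) :
    set (cube R d -> R) :=
  [set f | forall i, f (U i) = v i].

Section Mode.
Variables (k : cube R d -> cube R d -> R) (C : set (cube R d -> R)).
Context {n : nat} (X : 'I_n -> cube R d) (y : 'I_n -> R).

Definition mode_coefs S : set (coef_space S) :=
  argmin [set alpha | (interpolants X y `&` C) (interp alpha)]
    (fun alpha : coef_space S => (alpha^T *m invmx (gram k S) *m alpha) 0 0).

Definition mode_coef S : coef_space S :=
  xget (0 : 'cV[R]_#|{: lset S}|) (mode_coefs S).

Definition mode_fun S : cube R d -> R := interp (mode_coef S).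

End Mode.
End Multivariate.
End Subdivisions.
Arguments subdivision R : clear implicits.

Section MultiaffineExtension.
Context {R : realType} {d : nat}.

Definition box (F : 'I_d -> set R) : set (cube R d) :=
  [set x | forall i, F i (coord x i)].

Definition restr (F : 'I_d -> set R) (f : cube R d -> R) : box F -> R :=
  f \o val.

Definition is_multiaffine_ext {F : 'I_d -> set R} (f : box F -> R)
    (g : cube R d -> R) : Prop :=
  [/\ continuous g,
      restr F g = f
    & forall (i : 'I_d) (t : cube R d) (J : interval R),
        [set` J] `<=` `[0, 1]%classic `\` F i ->
        exists a b : R, forall x : cube R d,
          (forall j, j != i -> coord x j = coord t j) -> coord x i \in J ->
          g x = a * coord x i + b].

(** The extension exists and is unique when every [F i] is a closed subset of
    [0,1] containing 0 and 1 and [f] is continuous; the default value [0] is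
    irrelevant in that case. *)
Definition multiaffine_ext {F : 'I_d -> set R} (f : box F -> R) :
    cube R d -> R :=
  xget (fun=> 0) [set g | is_multiaffine_ext f g].

Definition constraint_on (F : 'I_d -> set R) (C : set (cube R d -> R)) :
    set (box F -> R) :=
  [set f | continuous f /\ C (multiaffine_ext f)].

Definition interpolants_on (F : 'I_d -> set R) {n : nat} (X : 'I_n -> cube R d)
    (y : 'I_n -> R) : set (box F -> R) :=
  [set f | continuous f /\ interpolants X y (multiaffine_ext f)].

Section RestrictedRKHS.
Context {k : cube R d -> cube R d -> R} (H : rkhs k) (F : 'I_d -> set R).

Definition rkhs_on : set (box F -> R) :=
  range (fun h : H => restr F (rkhs_fun H h)).

Definition rkhs_on_norm (f : box F -> R) : R :=
  inf [set `|h| | h in [set h : H | restr F (rkhs_fun H h) = f]].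

Definition limit_modes (C : set (cube R d -> R)) {n : nat}
    (X : 'I_n -> cube R d) (y : 'I_n -> R) : set (box F -> R) :=
  argmin (rkhs_on `&` constraint_on F C `&` interpolants_on F X y)
    rkhs_on_norm.

Definition limit_mode (C : set (cube R d -> R)) {n : nat}
    (X : 'I_n -> cube R d) (y : 'I_n -> R) : box F -> R :=
  xget (fun=> 0) (limit_modes C X y).

End RestrictedRKHS.

Definition limit_factor (S : nat -> 'I_d -> subdivision R) (m0 : nat)
    (i : 'I_d) : set R :=
  `[0, 1]%classic `&`
    closure (\bigcup_(m in [set m | (m0 <= m)%N]) sub_set (S m i)).

End MultiaffineExtension.

(* Main.v *)
Require Import Defs.
From HB Require Import structures.
From mathcomp Require Import all_boot all_order all_algebra sesquilinear.
From mathcomp Require Import all_classical all_reals all_analysis.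
From mathcomp Require Import ring lra zify.
Import Order.TTheory GRing.Theory Num.Theory.
Import numFieldNormedType.Exports.
Local Open Scope classical_set_scope.
Local Open Scope ring_scope.

(** Both the modes and their limit come from elements of minimal norm of the
    Hilbert space [H]. A quadratic form [alpha^T K^-1 alpha] given by a Gram
    matrix is the least squared norm of an element of [H] with values [alpha]
    at the nodes, and the norm of [H_F] is the least norm over a fibre of the
    restriction to [F]. Write [pi_m] and [P_F] for the multiaffine
    interpolation operators at the nodes of [S m] and at the points of [F]. The
    mode is [pi_m h_m], where [h_m] has minimal norm in
    [E_m = {h : pi_m h is in C and interpolates y at X}]
    ([mode_coefs_min]); the limit problem amounts to minimizing the norm over
    the analogous set [E_F] for [P_F] ([limit_modes_min]). So it suffices that
    [h_m] converges to [h_F] in [H] and that [pi_m h] tends to [P_F h]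
    uniformly on the cube, at a rate proportional to the norm of [h].

    Interpolation. In one variable the interpolant at a point only involves the
    two neighbouring knots; in several variables it is the composite of
    commuting one-dimensional interpolations [pli], so that its properties
    reduce to one variable. Interpolation at a coarser set of knots absorbs
    interpolation at a finer one, on both sides ([pla_fine_coarse],
    [pla_coarse_refine]). Uniform continuity is measured by bounds
    [|g x - g y| <= e + K |x - y|], which interpolation preserves up to a
    factor on [e] ([pls_coarse_lip]), and which give the error estimate
    [pls_approx] when the coarse knots are dense enough in the fine ones. By
    compactness the unit ball of [H] satisfies such a bound for every [e]
    ([rkhs_coarse]), whence the uniform convergence of [pi_m] to [P_F]
    ([rkhs_pla_cvg]).

    Minimal norms. Let [C_m] be the set of [h] with [pi_m h] in [C]. These sets
    are closed, convex, and decrease to the analogous set for [F], because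
    [pi_m] maps [C] to itself. Only the interpolation conditions vary without
    being monotone, and they converge in operator norm. The strict constraints
    provide an element [z] of [E_F] with a ball around it inside all the [C_m]:
    its values are prescribed at the finitely many neighbours in [F] of the
    coordinates of the points of [X] ([local_subdivision]). An element of [C_m]
    that almost satisfies the interpolation conditions can then be moved
    slightly towards [z] and corrected into [E_m] ([correction]). Applied to
    [h_F], this bounds the norm of [h_m] by that of [h_F], in the limit; applied
    to [h_m'] with [m <= m'], it shows that these norms are almost
    nondecreasing. By the parallelogram identity the sequence [h_m] is then
    Cauchy, and its limit is a minimizer in [E_F], hence [h_F]
    ([min_norm_cvg]). *)

Set Implicit Arguments.
Unset Strict Implicit.

(* [coord] also names the coordinates in a basis of a vector space *)
Local Notation coord := Defs.coord.

(** * Piecewise linear interpolation on the line *)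

Section PiecewiseLinear.
Context {R : realType}.
Implicit Types (F G : set R) (phi psi : R -> R) (s t : R).

Record knots F : Prop := Knots {
  knots_closed : closed F;
  knots_itv : F `<=` [set t | 0 <= t <= 1];
  knots0 : F 0;
  knots1 : F 1 }.

Definition lo F t := sup (F `&` [set s | s <= t]).
Definition up F t := inf (F `&` [set s | t <= s]).

(** For [a = b] the value is [p], since division by [0] yields [0]; this is the
    case of a cell reduced to a knot. *)
Definition line (a b p q t : R) := p + (t - a) / (b - a) * (q - p).

Definition pl F phi t := line (lo F t) (up F t) (phi (lo F t)) (phi (up F t)) t.

Lemma lo_spec F t : knots F -> 0 <= t <= 1 ->
  [/\ F (lo F t), lo F t <= t & forall s, F s -> s <= t -> s <= lo F t].
Proof.
move=> [cF F01 F0 F1] /andP[t0 t1].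
have ne : F `&` [set s | s <= t] !=set0 by exists 0.
have ub : has_ubound (F `&` [set s | s <= t]) by exists t => s [].
have cl : closed (F `&` [set s | s <= t]) by apply: closedI => //; exact: closed_le.
have [Fl lt] := cl _ (closure_sup ne ub).
by split=> // s Fs st; apply: ub_le_sup.
Qed.

Lemma up_spec F t : knots F -> 0 <= t <= 1 ->
  [/\ F (up F t), t <= up F t & forall s, F s -> t <= s -> up F t <= s].
Proof.
move=> [cF F01 F0 F1] /andP[t0 t1].
have ne : (F `&` [set s | t <= s]) !=set0 by exists 1.
have lb : has_lbound (F `&` [set s | t <= s]) by exists t => s [].
have cl : closed (F `&` [set s | t <= s]) by apply: closedI => //; exact: closed_ge.
have : closure (F `&` [set s | t <= s]) (up F t).
  move=> B /nbhs_ballP[e /= e0 eB].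
  have [s Gs se] := inf_adherent e0 (conj ne lb).
  exists s; split => //; apply: eB; rewrite /ball/= distrC ger0_norm ?ltrBlDl//.
  by rewrite subr_ge0; exact: ge_inf.
move=> /cl [Fl lt].
by split=> // s Fs st; apply: ge_inf.
Qed.

Lemma lo_eq F t a : knots F -> 0 <= t <= 1 ->
  F a -> a <= t -> (forall s, F s -> s <= t -> s <= a) -> lo F t = a.
Proof.
move=> kF t01 Fa at' am; have [Fl lt lm] := lo_spec kF t01.
by apply/eqP; rewrite eq_le am// lm.
Qed.

Lemma up_eq F t b : knots F -> 0 <= t <= 1 ->
  F b -> t <= b -> (forall s, F s -> t <= s -> b <= s) -> up F t = b.
Proof.
move=> kF t01 Fb tb bm; have [Fl lt lm] := up_spec kF t01.
by apply/eqP; rewrite eq_le bm// lm.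
Qed.

Lemma lo_id F t : knots F -> F t -> lo F t = t.
Proof. by move=> kF Ft; apply: lo_eq => //; exact: (knots_itv kF). Qed.

Lemma up_id F t : knots F -> F t -> up F t = t.
Proof. by move=> kF Ft; apply: up_eq => //; exact: (knots_itv kF). Qed.

Lemma line_l a b p q : line a b p q a = p.
Proof. by rewrite /line subrr !mul0r addr0. Qed.

Lemma line_r a b p q : a < b -> line a b p q b = q.
Proof. by move=> ab; rewrite /line; field; lra. Qed.

Lemma pl_id F phi t : knots F -> F t -> pl F phi t = phi t.
Proof. by move=> kF Ft; rewrite /pl lo_id// up_id// line_l. Qed.

Lemma weight_itv (a b t : R) : a <= t <= b -> 0 <= (t - a) / (b - a) <= 1.
Proof.
move=> /andP[at' tb]; have [ab|ba] := ltP a b.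
  apply/andP; split; first by rewrite divr_ge0; lra.
  by rewrite ler_pdivrMr; lra.
have -> : t = a by lra.
by rewrite subrr mul0r lexx ler01.
Qed.

(** Interpolation is affine on the closed cell around any point, not only on
    its interior, where [lo] and [up] are constant. *)
Lemma pl_cell F phi t s : knots F -> 0 <= t <= 1 -> lo F t <= s <= up F t ->
  pl F phi s = line (lo F t) (up F t) (phi (lo F t)) (phi (up F t)) s.
Proof.
move=> kF t01 /andP[ls su].
have [Fl lt lm] := lo_spec kF t01; have [Fu tu um] := up_spec kF t01.
have l01 := knots_itv kF Fl; have u01 := knots_itv kF Fu.
rewrite /= in l01 u01.
have s01 : 0 <= s <= 1 by lra.
have [Fs|nFs] := pselect (F s).
  rewrite pl_id//; have [st|/ltW ts] := leP s t.
    have -> : s = lo F t by apply/eqP; rewrite eq_le ls lm.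
    by rewrite line_l.
  have es : s = up F t by apply/eqP; rewrite eq_le su um.
  have [lu|ul] := ltP (lo F t) (up F t); first by rewrite es line_r.
  have -> : s = lo F t by lra.
  by rewrite line_l.
rewrite /pl; have -> : lo F s = lo F t.
  apply: lo_eq => // r Fr rs; have [rt|/ltW tr] := leP r t; first exact: lm.
  have ur := um _ Fr tr; case: nFs.
  by have -> : s = up F t; [lra|].
have -> // : up F s = up F t.
apply: up_eq => // r Fr sr; have [tr|/ltW rt] := leP t r; first exact: um.
have ur := lm _ Fr rt; case: nFs.
by have -> : s = lo F t; [lra|].
Qed.

Lemma pl_eq_on F phi psi t : knots F -> 0 <= t <= 1 ->
  (forall s, F s -> phi s = psi s) -> pl F phi t = pl F psi t.
Proof.
move=> kF t01 e; have [Fl _ _] := lo_spec kF t01.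
by have [Fu _ _] := up_spec kF t01; rewrite /pl !e.
Qed.

Lemma line_conv a b p q t :
  line a b p q t = (1 - (t - a) / (b - a)) * p + (t - a) / (b - a) * q.
Proof. rewrite /line; ring. Qed.

Lemma conv_dist_le (w p q p' q' e : R) : 0 <= w <= 1 ->
  `|p - p'| <= e -> `|q - q'| <= e ->
  `|((1 - w) * p + w * q) - ((1 - w) * p' + w * q')| <= e.
Proof.
move=> w01; rewrite !ler_norml => pe qe.
have -> : (1 - w) * p + w * q - ((1 - w) * p' + w * q') =
  (1 - w) * (p - p') + w * (q - q') by ring.
nra.
Qed.

Lemma pl_dist F phi psi t e : knots F -> 0 <= t <= 1 ->
  (forall s, F s -> `|phi s - psi s| <= e) -> `|pl F phi t - pl F psi t| <= e.
Proof.
move=> kF t01 h; have [Fl lt _] := lo_spec kF t01.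
have [Fu tu _] := up_spec kF t01.
by rewrite /pl !line_conv conv_dist_le ?h// weight_itv ?lt.
Qed.

Lemma line_line a b p q a' b' t : a <= a' -> a' <= t <= b' -> b' <= b ->
  line a' b' (line a b p q a') (line a b p q b') t = line a b p q t.
Proof.
move=> aa /andP[at' tb] bb; have [ab'|ba'] := ltP a' b'; last first.
  have -> : t = a' by lra.
  by rewrite line_l.
by rewrite /line; field; lra.
Qed.

(** A cell of the fine knots lies in a cell of the coarse ones, where the coarse
    interpolant is affine. *)
Lemma pl_refine F G phi t : knots F -> knots G -> G `<=` F -> 0 <= t <= 1 ->
  pl F (pl G phi) t = pl G phi t.
Proof.
move=> kF kG GF t01.
have [Fl lt lm] := lo_spec kF t01; have [Fu tu um] := up_spec kF t01.
have [Gl lt' _] := lo_spec kG t01; have [Gu tu' _] := up_spec kG t01.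
have al := lm _ (GF _ Gl) lt'; have bu := um _ (GF _ Gu) tu'.
rewrite {1}/pl !(@pl_cell G _ t)//; [|lra..].
by rewrite line_line//; lra.
Qed.

(** A quantitative form of uniform continuity: a slope bound that may fail by
    [e] at small scales. Interpolation preserves the slope and multiplies [e] by
    a constant, whatever the lengths of the cells. *)
Definition coarse_lip1 (e K : R) phi := forall s t, 0 <= s <= 1 -> 0 <= t <= 1 ->
  `|phi s - phi t| <= e + K * `|s - t|.

Lemma line_coarse a b p q s t e K : 0 <= e -> 0 <= K ->
  `|p - q| <= e + K * (b - a) -> a <= s -> s <= t -> t <= b ->
  `|line a b p q s - line a b p q t| <= e + K * (t - s).
Proof.
move=> e0 K0 pq as' st tb; have [ab|ba] := ltP a b; last first.
  have -> : s = t by lra.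
  by rewrite !subrr normr0 mulr0 addr0.
have -> : line a b p q s - line a b p q t = (t - s) / (b - a) * (p - q).
  by rewrite /line; field; lra.
have w0 : 0 <= (t - s) / (b - a) by rewrite divr_ge0; lra.
have w1 : (t - s) / (b - a) <= 1 by rewrite ler_pdivrMr; lra.
rewrite normrM (ger0_norm w0).
have -> : t - s = (t - s) / (b - a) * (b - a) by field; lra.
have -> : (t - s) / (b - a) * (b - a) / (b - a) = (t - s) / (b - a).
  by field; lra.
move: ((t - s) / (b - a)) w0 w1 => w w0 w1.
apply: (le_trans (ler_wpM2l w0 pq)); rewrite mulrDr lerD//.
  by rewrite -[leRHS]mul1r ler_wpM2r.
by rewrite mulrCA.
Qed.

(** Two points in different cells are linked through the knots next to them,
    hence the three error terms. *)
Lemma pl_coarse F phi e K : knots F -> 0 <= e -> 0 <= K ->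
  coarse_lip1 e K phi -> coarse_lip1 (e *+ 3) K (pl F phi).
Proof.
move=> kF e0 K0 lphi s t.
wlog st : s t / s <= t => [hw|s01 t01].
  have [ts s01 t01|/ltW] := leP t s; last exact: hw.
  by rewrite distrC [`|s - _|]distrC; exact: hw.
rewrite [`|s - t|]distrC [`|t - s|]ger0_norm ?subr_ge0//.
have step a b : F a -> F b -> a <= b -> `|phi a - phi b| <= e + K * (b - a).
  move=> Fa Fb ab; rewrite -(ger0_norm (_ : 0 <= b - a)) ?subr_ge0// distrC.
  by rewrite lphi//; exact: (knots_itv kF).
have cell r a b : 0 <= r <= 1 -> lo F r <= a -> a <= b -> b <= up F r ->
    `|pl F phi a - pl F phi b| <= e + K * (b - a).
  move=> r01 ra ab br; have [Fl _ _] := lo_spec kF r01.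
  have [Fu _ _] := up_spec kF r01.
  rewrite !(@pl_cell _ _ r)//; [|lra..].
  by apply: line_coarse => //; apply: step => //; lra.
have [Fl lt lm] := lo_spec kF t01; have [Fu su um] := up_spec kF s01.
have [Fu' tu _] := up_spec kF t01; have [Fl' ls _] := lo_spec kF s01.
have [usl|lus] := leP (up F s) (lo F t).
  have h1 := cell s s (up F s) s01 ls su (lexx _).
  have h3 := cell t (lo F t) t t01 (lexx _) lt tu.
  have h2 := step _ _ Fu Fl usl.
  rewrite (pl_id phi kF Fu) in h1; rewrite (pl_id phi kF Fl) in h3.
  move: h1 h2 h3; rewrite !ler_norml; lra.
have lts : lo F t <= s.
  by rewrite leNgt; apply/negP => sl; move: (um _ Fl (ltW sl)); lra.
apply: (le_trans (cell t s t t01 lts st tu)).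
by rewrite lerD2r mulrS lerDl mulrn_wge0.
Qed.

(** At a knot [p] of the fine set the interpolant averages values taken at
    distances inversely proportional to the weights, so that the nearer end of
    the coarse cell controls the error whatever the length of the cell; between
    fine knots both functions are affine. *)
Lemma pl_approx F G phi e K eta : knots F -> knots G -> G `<=` F ->
  0 <= e -> 0 <= K ->
  coarse_lip1 e K phi ->
  (forall p, F p -> exists2 s, G s & `|s - p| <= eta) ->
  (forall t, 0 <= t <= 1 -> pl F phi t = phi t) ->
  forall t, 0 <= t <= 1 -> `|pl G phi t - phi t| <= e + K * (eta *+ 2).
Proof.
move=> kF kG GF e0 K0 lphi dense fixF t t01.
rewrite -(pl_refine phi kF kG GF t01) -[X in _ - X]fixF//.
apply: pl_dist => // p Fp; have p01 := knots_itv kF Fp.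
have [Gl lp lm] := lo_spec kG p01; have [Gu pu um] := up_spec kG p01.
have h1 := lphi _ _ (knots_itv kG Gl) p01.
have h2 := lphi _ _ (knots_itv kG Gu) p01.
rewrite (ler0_norm (_ : lo G p - p <= 0)) ?subr_le0// in h1.
rewrite (ger0_norm (_ : 0 <= up G p - p)) ?subr_ge0// in h2.
have [s Gs] := dense _ Fp; rewrite ler_norml => /andP[sp1 sp2].
have w01 := @weight_itv _ _ p (introT andP (conj lp pu)).
have eta0 : 0 <= eta by lra.
have wE : (p - lo G p) / (up G p - lo G p) * (up G p - lo G p) = p - lo G p.
  have [lu|ul] := ltP (lo G p) (up G p); first by field; lra.
  by rewrite (_ : up G p - lo G p = 0) ?mulr0; lra.
rewrite /pl line_conv.
move: ((p - lo G p) / (up G p - lo G p)) w01 wE h1 h2 => w w01 wE h1 h2.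
have {}h : `|(1 - w) * phi (lo G p) + w * phi (up G p) - phi p| <=
    (1 - w) * (e + K * (p - lo G p)) + w * (e + K * (up G p - p)).
  move: h1 h2; rewrite !ler_norml !opprB => /andP[h11 h12] /andP[h21 h22].
  apply/andP; split; nra.
apply: (le_trans h).
have -> : (1 - w) * (e + K * (p - lo G p)) + w * (e + K * (up G p - p)) =
  e + K * ((1 - w) * (p - lo G p) + w * (up G p - p)) by ring.
rewrite lerD2l ler_wpM2l// mulr2n.
have [sp|/ltW ps] := leP s p.
  by have := lm _ Gs sp; nra.
by have := um _ Gs ps; nra.
Qed.

Lemma pl_linear F phi psi (a : R) t :
  pl F (fun s => a * phi s + psi s) t = a * pl F phi t + pl F psi t.
Proof. rewrite /pl /line; ring. Qed.

Lemma lo_up_gap F s t : knots F -> 0 <= s -> s <= t -> t <= 1 ->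
  (forall r, F r -> s <= r <= t -> False) -> lo F s = lo F t /\ up F s = up F t.
Proof.
move=> kF s0 st t1 gap.
have s01 : 0 <= s <= 1 by lra.
have t01 : 0 <= t <= 1 by lra.
have [Fl lt lm] := lo_spec kF t01; have [Fu su um] := up_spec kF s01.
split.
  apply: lo_eq => //; last by move=> r Fr rs; apply: lm => //; lra.
  by rewrite leNgt; apply/negP => sl; apply: (gap _ Fl); lra.
symmetry; apply: up_eq => //; last by move=> r Fr rs; apply: um => //; lra.
by rewrite leNgt; apply/negP => sl; apply: (gap _ Fu); lra.
Qed.

Lemma pl_affine_gap F phi (J : interval R) : knots F ->
  [set` J] `<=` `[0, 1]%classic `\` F ->
  exists a b : R, forall t, t \in J -> pl F phi t = a * t + b.
Proof.
move=> kF JF.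
have [[s Js]|nJ] := pselect (exists s, s \in J); last first.
  by exists 0, 0 => t Jt; case: nJ; exists t.
set d := up F s - lo F s; set p := phi (lo F s); set q := phi (up F s).
exists ((q - p) / d), (p - lo F s * (q - p) / d) => t Jt.
rewrite /pl /line /d /p /q.
suff [-> ->] : lo F s = lo F t /\ up F s = up F t by ring.
have [/= ] := JF _ Js; rewrite in_itv/= => s01 nFs.
have [/= ] := JF _ Jt; rewrite in_itv/= => t01 nFt.
have iJ := @interval_is_interval _ J.
have [st|/ltW ts] := leP s t.
  apply: lo_up_gap => //; [lra..|move=> r Fr srt].
  by have [] := JF r (iJ _ _ Js Jt r srt).
by have [||||-> ->] := @lo_up_gap F t s kF => //; [lra..|move=> r Fr /(iJ _ _ Jt Js)/JF[]].
Qed.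

(** Affinity on the open gap extends to its end points, which are knots, by
    continuity. *)
Lemma affine_gap_pl F phi : knots F ->
  (forall t, 0 <= t <= 1 -> {for t, continuous phi}) ->
  (forall J : interval R, [set` J] `<=` `[0, 1]%classic `\` F ->
     exists a b : R, forall t, t \in J -> phi t = a * t + b) ->
  forall t, 0 <= t <= 1 -> pl F phi t = phi t.
Proof.
move=> kF cphi aff t t01.
have [Ft|nFt] := pselect (F t); first exact: pl_id.
have [Fl lt lm] := lo_spec kF t01; have [Fu tu um] := up_spec kF t01.
have l01 := knots_itv kF Fl; have u01 := knots_itv kF Fu; rewrite /= in l01 u01.
have {}lt : lo F t < t.
  by rewrite lt_neqAle lt andbT; apply: contra_notN nFt => /eqP <-.
have {}tu : t < up F t.
  by rewrite lt_neqAle tu andbT; apply: contra_notN nFt => /eqP ->.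
have [a [b phiE]] : exists a b : R,
    forall s, s \in `]lo F t, up F t[ -> phi s = a * s + b.
  apply: aff => s /=; rewrite !in_itv/= => lsu; split => [|Fs].
    by lra.
  have [/(lm _ Fs)|/ltW/(um _ Fs)] := leP s t; lra.
(* both sides of [phi = a * _ + b] are continuous, hence agree at the ends *)
have aff_cont (x : R) : {for x, continuous (fun s : R => a * s + b)}.
  by apply: cvgD; [apply: cvgM; [exact: cvg_cst|exact: cvg_id]|exact: cvg_cst].
have phil : phi (lo F t) = a * lo F t + b.
  have h1 : phi x @[x --> (lo F t)^'+] --> phi (lo F t).
    by apply: cvg_at_right_filter; exact: cphi.
  have h2 : phi x @[x --> (lo F t)^'+] --> a * lo F t + b.
    apply: (@cvg_trans _ ((fun s : R => a * s + b) x @[x --> (lo F t)^'+])).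
      apply: near_eq_cvg; near=> x; rewrite phiE// in_itv/=; apply/andP; split => //.
      by near: x; apply: nbhs_right_lt; lra.
    by apply: cvg_at_right_filter; exact: aff_cont.
  exact: cvg_unique h1 h2.
have phiu : phi (up F t) = a * up F t + b.
  have h1 : phi x @[x --> (up F t)^'-] --> phi (up F t).
    by apply: cvg_at_left_filter; exact: cphi.
  have h2 : phi x @[x --> (up F t)^'-] --> a * up F t + b.
    apply: (@cvg_trans _ ((fun s : R => a * s + b) x @[x --> (up F t)^'-])).
      apply: near_eq_cvg; near=> x; rewrite phiE// in_itv/=; apply/andP; split => //.
      by near: x; apply: nbhs_left_gt; lra.
    by apply: cvg_at_left_filter; exact: aff_cont.
  exact: cvg_unique h1 h2.
rewrite /pl phil phiu phiE ?in_itv/= ?lt ?tu// /line; field; lra.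
Unshelve. all: by end_near.
Qed.

End PiecewiseLinear.

(** * Coordinates and topology of the cube *)

Section Cube.
Context {R : realType} {d : nat}.
Implicit Types (x y : cube R d) (i j : 'I_d) (g : cube R d -> R).

Lemma coord_mkcube (c : 'I_d -> R) (hc : forall i, 0 <= c i <= 1) i :
  coord (mkcube hc) i = c i.
Proof. by rewrite /coord /mkcube/= mxE. Qed.

Lemma cube_ext x y : (forall i, coord x i = coord y i) -> x = y.
Proof.
by move=> e; apply: val_inj; apply/rowP => i; have := e i; rewrite /coord.
Qed.

Definition clamp (a : R) : R := Num.max 0 (Num.min a 1).

Lemma clamp_itv a : 0 <= clamp a <= 1.
Proof. by rewrite /clamp le_max lexx ge_max ler01 ge_min lexx orbT. Qed.

Lemma clamp_id a : 0 <= a <= 1 -> clamp a = a.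
Proof. by move=> /andP[a0 a1]; rewrite /clamp min_l// max_r. Qed.

Lemma clamp_dist a b : `|clamp a - clamp b| <= `|a - b|.
Proof.
have h1 := ler_norm (a - b); have := ler_norm (b - a); rewrite distrC => h2.
rewrite /clamp ler_norml.
have h01 := @ler01 R.
case: (leP a 1) => ?; case: (leP b 1) => ?; rewrite ?(max_r h01);
  by case: (leP 0 a) => ?; case: (leP 0 b) => ?; apply/andP; split; lra.
Qed.

Lemma upd_subproof x i a j : 0 <= (if j == i then clamp a else coord x j) <= 1.
Proof. by case: ifP => _; [exact: clamp_itv|exact: coord_itv]. Qed.

(** Clamping makes the new coordinate a total argument; only values in [0,1]
    are ever of interest. *)
Definition upd x i (a : R) : cube R d := mkcube (upd_subproof x i a).

Lemma coord_upd x i a j : 0 <= a <= 1 ->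
  coord (upd x i a) j = if j == i then a else coord x j.
Proof. by move=> a01; rewrite coord_mkcube clamp_id. Qed.

Lemma coord_upd_ne x i a j : j != i -> coord (upd x i a) j = coord x j.
Proof. by move=> /negbTE ji; rewrite coord_mkcube ji. Qed.

Lemma upd_id x i : upd x i (coord x i) = x.
Proof.
apply: cube_ext => j; rewrite coord_upd ?coord_itv//.
by case: eqP => // ->.
Qed.

Lemma upd_upd x i a b : upd (upd x i a) i b = upd x i b.
Proof.
by apply: cube_ext => j; rewrite !coord_mkcube; case: (j == i).
Qed.

Lemma upd_comm x i j a b : i != j ->
  upd (upd x i a) j b = upd (upd x j b) i a.
Proof.
move=> ij; apply: cube_ext => l; rewrite !coord_mkcube.
by case: (eqVneq l j) => [->|//]; rewrite eq_sym (negbTE ij).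
Qed.

Lemma cube_ballP x y (e : R) : 0 < e ->
  ball x e y <-> forall i, `|coord x i - coord y i| < e.
Proof.
move=> e0; rewrite -(initial_ballE (f := set_val)); split.
  by move=> [_ /(_ ord0)].
by move=> h; split => // i j; rewrite (ord1 i); exact: h.
Qed.

Lemma cube_continuousP g : continuous g <-> forall x (e : R), 0 < e ->
  exists2 dl : R, 0 < dl &
    forall y, (forall i, `|coord x i - coord y i| < dl) -> `|g x - g y| < e.
Proof.
split=> [cg x e e0|h x].
  have /cvgrPdist_lt/(_ e e0)/nbhs_ballP[dl /= dl0 dle] := cg x.
  by exists dl => // y /(cube_ballP x y dl0)/dle.
apply/(@cvgrPdist_lt _ _ _ _ (nbhs_filter x)) => e e0.
have [dl dl0 dle] := h x e e0.
by apply/nbhs_ballP; exists dl => // y /(cube_ballP x y dl0)/dle.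
Qed.

Lemma upd_continuous x i g : continuous g -> continuous (fun a => g (upd x i a)).
Proof.
move=> cg a; apply/cvgrPdist_lt => e e0.
have [dl dl0 dle] := (cube_continuousP g).1 cg (upd x i a) e e0.
apply/nbhs_ballP; exists dl => //= b; rewrite /ball/= => ab; apply: dle => j.
rewrite !coord_mkcube; case: ifP => _; last by rewrite subrr normr0.
exact: le_lt_trans (clamp_dist a b) ab.
Qed.

(** The l1 distance suits bounds proved one coordinate at a time. *)
Definition dist1 x y : R := \sum_i `|coord x i - coord y i|.

Lemma dist1_upd x i a b : 0 <= a <= 1 -> 0 <= b <= 1 ->
  dist1 (upd x i a) (upd x i b) = `|a - b|.
Proof.
move=> a01 b01; rewrite /dist1 (bigD1 i)//= !coord_upd// eqxx big1 ?addr0//.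
by move=> j ji; rewrite !coord_upd_ne// subrr normr0.
Qed.

Lemma dist1_split x y i a :
  dist1 x y = `|coord x i - coord y i| + dist1 (upd x i a) (upd y i a).
Proof.
rewrite /dist1 (bigD1 i)//= [in RHS](bigD1 i)//= !coord_mkcube eqxx subrr.
rewrite normr0 add0r; congr +%R; apply: eq_bigr => j ji.
by rewrite !coord_upd_ne.
Qed.

Definition coarse_lip (e K : R) g :=
  forall x y, `|g x - g y| <= e + K * dist1 x y.

Lemma coarse_lip_upd e K g x i : coarse_lip e K g ->
  coarse_lip1 e K (fun a => g (upd x i a)).
Proof. by move=> lg a b a01 b01; rewrite -(dist1_upd x i a01 b01). Qed.

Lemma coarse_lip_continuous g :
  (forall e : R, 0 < e -> exists2 K, 0 <= K & coarse_lip e K g) -> continuous g.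
Proof.
move=> lg; apply/cube_continuousP => x e e0.
have [|K K0 lK] := lg (e / 2); first by rewrite divr_gt0.
have c0 : 0 < e / 2 / (K + 1) / d.+1%:R.
  by rewrite !divr_gt0 ?ltr0n//; lra.
exists (e / 2 / (K + 1) / d.+1%:R) => // y xy.
apply: (le_lt_trans (lK x y)).
have : dist1 x y <= e / 2 / (K + 1).
  have -> : e / 2 / (K + 1) = e / 2 / (K + 1) / d.+1%:R * d.+1%:R.
    by rewrite divfK ?pnatr_eq0.
  apply: (@le_trans _ _ (\sum_(i < d) e / 2 / (K + 1) / d.+1%:R)).
    by apply: ler_sum => i _; exact: ltW.
  by rewrite sumr_const card_ord -[leLHS]mulr_natr ler_wpM2l ?(ltW c0)// ler_nat.
move=> /(ler_wpM2l K0) h.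
have : K * (e / 2 / (K + 1)) < e / 2.
  rewrite mulrA ltr_pdivrMr; nra.
lra.
Qed.

End Cube.

(** * Multiaffine interpolation on the cube *)

Section MultiaffineInterpolation.
Context {R : realType} {d : nat}.
Implicit Types (x y : cube R d) (i j : 'I_d) (f g : cube R d -> R).
Implicit Types (F G : 'I_d -> set R) (s : seq 'I_d).

Definition pli F i g x : R := pl (F i) (fun a => g (upd x i a)) (coord x i).

(** The multiaffine interpolant is the composite of the one-dimensional
    interpolations in the successive coordinates: they commute, so that each
    of its properties reduces to one variable. *)
Definition pls F s g := foldr (pli F) g s.

Definition pla F g := pls F (index_enum 'I_d) g.

Lemma pli_comm F G i j g : i != j -> pli F i (pli G j g) = pli G j (pli F i g).
Proof.
move=> ij; apply/funext => x; rewrite /pli /pl.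
rewrite !coord_upd_ne ?[j == i]eq_sym// ![upd (upd x i _) j _]upd_comm//.
rewrite !line_conv; ring.
Qed.

Lemma pli_refine F G i g : knots (F i) -> knots (G i) -> G i `<=` F i ->
  pli F i (pli G i g) = pli G i g.
Proof.
move=> kF kG GF; apply/funext => x.
rewrite /pli -[RHS](pl_refine _ kF kG GF) ?coord_itv//.
apply: pl_eq_on => // [|a Fa]; first exact: coord_itv.
have a01 := knots_itv kF Fa; rewrite coord_upd// eqxx.
by congr pl; apply/funext => b; rewrite upd_upd.
Qed.

Lemma pls_fixed F G s i g : (forall j, knots (F j)) -> (forall j, knots (G j)) ->
  i \in s -> G i `<=` F i -> pli F i (pls G s g) = pls G s g.
Proof.
move=> kF kG + GF; elim: s => //= j s IH; rewrite inE.
have [<- _|ij /= si] := eqVneq i j; first exact: pli_refine.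
by rewrite pli_comm// IH.
Qed.

Lemma pls_id F s g : (forall i, i \in s -> pli F i g = g) -> pls F s g = g.
Proof.
elim: s => //= i s IH h; rewrite IH; first by rewrite h// mem_head.
by move=> j sj; rewrite h// inE sj orbT.
Qed.

Lemma pla_fixed F G i g : (forall j, knots (F j)) -> (forall j, knots (G j)) ->
  G i `<=` F i -> pli F i (pla G g) = pla G g.
Proof. by move=> kF kG; apply: pls_fixed => //; rewrite mem_index_enum. Qed.

Lemma pla_coarse_refine F G g :
  (forall j, knots (F j)) -> (forall j, knots (G j)) ->
  (forall i, G i `<=` F i) -> pla F (pla G g) = pla G g.
Proof. by move=> kF kG GF; apply: pls_id => i _; exact: pla_fixed. Qed.

Lemma pls_box F s g x : (forall i, knots (F i)) -> box F x -> pls F s g x = g x.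
Proof.
move=> kF Fx; elim: s => //= i s IH; rewrite /pli pl_id//.
by rewrite upd_id.
Qed.

Lemma pli_val F i g x : pli F i g x =
  line (lo (F i) (coord x i)) (up (F i) (coord x i))
    (g (upd x i (lo (F i) (coord x i)))) (g (upd x i (up (F i) (coord x i))))
    (coord x i).
Proof. by []. Qed.

(** Expanding the first interpolation moves a coordinate of [x] into the knots;
    the others keep their value until their turn comes. *)
Lemma pls_eq_box F s g g' x : (forall i, knots (F i)) ->
  (forall y, (forall j, j \in s -> F j (coord y j)) ->
     (forall j, j \notin s -> coord y j = coord x j) -> g y = g' y) ->
  pls F s g x = pls F s g' x.
Proof.
move=> kF; elim: s x => [|i s IH] x h /=.
  by apply: h => // j; rewrite in_nil.
have x01 := coord_itv x i.
have [Fl _ _] := lo_spec (kF i) x01; have [Fu _ _] := up_spec (kF i) x01.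
suff e a : F i a -> pls F s g (upd x i a) = pls F s g' (upd x i a).
  by rewrite !pli_val !e.
move=> Fa; have a01 := knots_itv (kF i) Fa; apply: IH => y ys yns; apply: h => j.
  rewrite inE => /predU1P[->|]; last exact: ys.
  have [/ys//|/yns ->] := boolP (i \in s).
  by rewrite coord_upd// eqxx.
by rewrite inE negb_or => /andP[ji /yns ->]; rewrite coord_upd_ne.
Qed.

Lemma pla_eq_box F g g' : (forall i, knots (F i)) ->
  (forall x, box F x -> g x = g' x) -> pla F g = pla F g'.
Proof.
move=> kF h; apply/funext => x; apply: pls_eq_box => // y yF _.
by apply: h => i; apply: yF; rewrite mem_index_enum.
Qed.

Lemma pla_fine_coarse F G g :
  (forall j, knots (F j)) -> (forall j, knots (G j)) ->
  (forall i, G i `<=` F i) -> pla G (pla F g) = pla G g.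
Proof.
move=> kF kG GF; apply: pla_eq_box => // x Gx.
by apply: pls_box => // i; apply: GF; exact: Gx.
Qed.

(** The value at [x] involves the knots next to the coordinates of [x] only. *)
Lemma pls_local F G s g x : (forall i, knots (F i)) -> uniq s ->
  (forall i, i \in s -> lo (F i) (coord x i) = lo (G i) (coord x i) /\
     up (F i) (coord x i) = up (G i) (coord x i)) ->
  pls F s g x = pls G s g x.
Proof.
move=> kF; elim: s x => //= i s IH x /andP[nis us] h.
suff e a : pls F s g (upd x i a) = pls G s g (upd x i a).
  by rewrite !pli_val !e; have [-> ->] := h i (mem_head _ _).
apply: IH => // j sj.
have ji : j != i by apply: contraNneq nis => <-.
by rewrite !coord_upd_ne//; apply: h; rewrite inE sj orbT.
Qed.

Lemma pla_local F G g x : (forall i, knots (F i)) ->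
  (forall i, lo (F i) (coord x i) = lo (G i) (coord x i) /\
     up (F i) (coord x i) = up (G i) (coord x i)) ->
  pla F g x = pla G g x.
Proof. by move=> kF h; apply: pls_local => //; exact: index_enum_uniq. Qed.

Lemma pls_dist F s g g' e : (forall i, knots (F i)) ->
  (forall x, `|g x - g' x| <= e) -> forall x, `|pls F s g x - pls F s g' x| <= e.
Proof.
move=> kF h; elim: s => //= i s IH x.
by apply: pl_dist => //; exact: coord_itv.
Qed.

Lemma pls_linear F s g g' (a : R) :
  pls F s (fun x => a * g x + g' x) = (fun x => a * pls F s g x + pls F s g' x).
Proof.
elim: s => //= i s ->; apply/funext => x.
by rewrite /pli -pl_linear.
Qed.

(** Changing the [i]-th coordinate costs [3 e] by [pl_coarse]; changing the
    others compares averages with the same weights and costs [e]. *)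
Lemma pls_coarse_lip F s g e K : (forall i, knots (F i)) -> 0 <= e -> 0 <= K ->
  coarse_lip e K g -> coarse_lip (e * 4 ^+ size s) K (pls F s g).
Proof.
move=> kF e0 K0 lg; elim: s => [|i s IH]/=; first by rewrite mulr1.
have {e0} : 0 <= e * 4 ^+ size s by rewrite mulr_ge0// exprn_ge0.
rewrite exprS mulrCA.
move: (pls F s g) (e * 4 ^+ size s) IH => {lg g e} g e lg e0 x y.
rewrite (dist1_split x y i 0).
have h1 := pl_coarse (kF i) e0 K0 (coarse_lip_upd x i lg)
  (coord_itv x i) (coord_itv y i).
have h2 : `|pl (F i) (fun a => g (upd x i a)) (coord y i) - pli F i g y| <=
    e + K * dist1 (upd x i 0) (upd y i 0).
  apply: pl_dist => //; first exact: coord_itv.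
  move=> a Fa; apply: (le_trans (lg _ _)); rewrite lerD2l ler_wpM2l//.
  apply: ler_sum => j _; rewrite !coord_mkcube.
  by case: ifP => // _; rewrite !subrr normr0.
rewrite /pli in h1 h2 *.
move: h1 h2; rewrite !ler_norml mulrDr; lra.
Qed.

(** The error of the coarse interpolation adds up over the coordinates, because
    each one-dimensional interpolation is a contraction. *)
Lemma pls_approx F G s g e K eta :
  (forall i, knots (F i)) -> (forall i, knots (G i)) ->
  (forall i, G i `<=` F i) -> 0 <= e -> 0 <= K -> coarse_lip e K g ->
  (forall i p, F i p -> exists2 r, G i r & `|r - p| <= eta) ->
  (forall i, pli F i g = g) ->
  forall x, `|pls G s g x - g x| <= (e + K * (eta *+ 2)) *+ size s.
Proof.
move=> kF kG GF e0 K0 lg dense fixg; elim: s => [|i s IH] x /=.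
  by rewrite subrr normr0 mulr0n.
have h1 : `|pli G i (pls G s g) x - pli G i g x| <=
    (e + K * (eta *+ 2)) *+ size s.
  by apply: (pls_dist [:: i]).
have h2 : `|pli G i g x - g x| <= e + K * (eta *+ 2).
  rewrite -[X in _ - g X](upd_id x i) /pli.
  apply: (pl_approx (kF i) (kG i) (GF i) e0 K0 (coarse_lip_upd x i lg)) => //.
  - exact: dense.
  - move=> t t01; rewrite -[in RHS](fixg i) /pli coord_upd// eqxx.
    by congr pl; apply/funext => b; rewrite upd_upd.
  - exact: coord_itv.
rewrite mulrS; move: h1 h2; move: (_ *+ size s) => c.
rewrite !ler_norml; lra.
Qed.

Lemma pli_affine F i j g : knots (F j) -> i != j ->
  (forall t (J : interval R), [set` J] `<=` `[0, 1]%classic `\` F i ->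
   exists a b : R, forall x, (forall l, l != i -> coord x l = coord t l) ->
     coord x i \in J -> g x = a * coord x i + b) ->
  forall t (J : interval R), [set` J] `<=` `[0, 1]%classic `\` F i ->
   exists a b : R, forall x, (forall l, l != i -> coord x l = coord t l) ->
     coord x i \in J -> pli F j g x = a * coord x i + b.
Proof.
move=> kF ij ag t J JF; set u := lo (F j) (coord t j); set v := up (F j) (coord t j).
have [a [b ab]] := ag (upd t j u) J JF; have [a' [b' ab']] := ag (upd t j v) J JF.
pose w := (coord t j - u) / (v - u).
exists ((1 - w) * a + w * a'), ((1 - w) * b + w * b') => x xt xJ.
have xj : coord x j = coord t j by rewrite xt// eq_sym.
have E r : (forall l, l != i -> coord (upd x j r) l = coord (upd t j r) l).
  by move=> l li; rewrite !coord_mkcube; case: ifP => // _; exact: xt.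
rewrite pli_val line_conv xj -/u -/v -/w.
rewrite (ab _ (E u)) ?coord_upd_ne// (ab' _ (E v)) ?coord_upd_ne//; ring.
Qed.

Lemma pli_affine_self F i g : knots (F i) ->
  forall t (J : interval R), [set` J] `<=` `[0, 1]%classic `\` F i ->
   exists a b : R, forall x, (forall l, l != i -> coord x l = coord t l) ->
     coord x i \in J -> pli F i g x = a * coord x i + b.
Proof.
move=> kF t J JF.
have [a [b ab]] := pl_affine_gap (fun a => g (upd t i a)) kF JF.
exists a, b => x xt xJ; rewrite -ab// /pli; congr pl; apply/funext => r.
congr g; apply: cube_ext => l; rewrite !coord_mkcube; case: eqVneq => // li.
exact: xt.
Qed.

Lemma pls_affine F i s g : (forall i, knots (F i)) -> i \in s ->
  forall t (J : interval R), [set` J] `<=` `[0, 1]%classic `\` F i ->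
   exists a b : R, forall x, (forall l, l != i -> coord x l = coord t l) ->
     coord x i \in J -> pls F s g x = a * coord x i + b.
Proof.
move=> kF; elim: s => //= j s IH; rewrite inE.
have [<- _|ij /= /IH] := eqVneq i j; first exact: pli_affine_self.
exact: pli_affine.
Qed.

Definition coarse_lips g := forall e : R, 0 < e -> exists2 K, 0 <= K & coarse_lip e K g.

Lemma pla_coarse_lips F g : (forall i, knots (F i)) ->
  coarse_lips g -> coarse_lips (pla F g).
Proof.
move=> kF lg e e0; set N := size (index_enum 'I_d).
have N0 : (0 : R) < 4 ^+ N by rewrite exprn_gt0.
have [|K K0 lK] := lg (e / 4 ^+ N); first by rewrite divr_gt0.
exists K => //.
have -> : e = e / 4 ^+ N * 4 ^+ N by rewrite divfK// gt_eqF.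
by apply: pls_coarse_lip => //; rewrite divr_ge0 ?ltW.
Qed.

Lemma multiaffine_ext_fixed F (f : box F -> R) g : (forall i, knots (F i)) ->
  is_multiaffine_ext f g -> forall i, pli F i g = g.
Proof.
move=> kF [cg gf ag] i; apply/funext => x.
rewrite -[in RHS](upd_id x i) /pli; apply: affine_gap_pl => //.
- by move=> t _; exact: upd_continuous.
- move=> J JF; have [a [b ab]] := ag i x J JF; exists a, b => t Jt.
  have [/=] := JF _ Jt; rewrite in_itv/= => t01 _.
  rewrite (ab (upd x i t)) ?coord_upd// ?eqxx//.
  by move=> j ji; rewrite coord_upd_ne.
- exact: coord_itv.
Qed.

(** An extension is fixed by every one-dimensional interpolation,
    hence equals its own interpolant, which is determined by the values on the
    box. *)
Lemma multiaffine_extE F g : (forall i, knots (F i)) -> coarse_lips g ->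
  multiaffine_ext (restr F g) = pla F g.
Proof.
move=> kF lg; have ext : is_multiaffine_ext (restr F g) (pla F g).
  split.
  - exact/coarse_lip_continuous/pla_coarse_lips.
  - apply/funext => x; rewrite /restr/=; apply: pls_box => //.
    exact: (set_mem (valP x)).
  - by move=> i t J JF; apply: pls_affine => //; rewrite mem_index_enum.
apply: xget_unique => // h hext.
have fixh := multiaffine_ext_fixed kF hext.
rewrite -[LHS](pls_id (F := F) (s := index_enum 'I_d)) => [|i _]; last exact: fixh.
apply: pla_eq_box => // x Fx; have [_ /funeqP hg _] := hext.
exact: (hg (exist _ x (mem_set Fx))).
Qed.

End MultiaffineInterpolation.

(** * Subdivisions and their hat functions *)

Section SubdivisionKnots.
Context {R : realType}.
Implicit Types (s : subdivision R) (t : R).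

Definition sub_knots s : set R := sub_set s `&` [set t | 0 <= t <= 1].

Lemma sub_node_lt s (a b : nat) :
  (a < b)%N -> (b < (sub_size s).+2)%N -> sub_node s a < sub_node s b.
Proof.
move=> ab hb; apply: (sorted_ltn_nth lt_trans 0 (Defs.sub_sorted s)) => //.
  by rewrite inE size_tuple (ltn_trans ab).
by rewrite inE size_tuple.
Qed.

Lemma sub_node_le s (a b : nat) :
  (a <= b)%N -> (b < (sub_size s).+2)%N -> sub_node s a <= sub_node s b.
Proof.
by rewrite leq_eqVlt => /predU1P[->//|ab hb]; rewrite ltW// sub_node_lt.
Qed.

Lemma sub_node_set s (a : nat) : (a < (sub_size s).+2)%N ->
  sub_set s (sub_node s a).
Proof. by move=> ha; rewrite /sub_set /= mem_nth// size_tuple. Qed.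

Lemma sub_setP s t : sub_set s t ->
  exists2 a, (a < (sub_size s).+2)%N & t = sub_node s a.
Proof.
move=> st; exists (index t (sub_nodes s)); last by rewrite /sub_node nth_index.
by have := st; rewrite /sub_set /= -index_mem size_tuple.
Qed.

Lemma sub_size_gt1 s : (1 < sub_size s)%N.
Proof.
have n0 : sub_node s 0 = -1 := sub_node0 s.
have n1 : sub_node s 1 = 0 := sub_node1 s.
have nm : sub_node s (sub_size s) = 1 := sub_node_size s.
case E : (sub_size s) => [|[|//]]; rewrite E in nm.
  by rewrite nm in n0; lra.
by rewrite nm in n1; lra.
Qed.

Lemma sub_set_node s t : 0 <= t <= 1 -> sub_set s t ->
  exists j : 'I_(sub_size s), t = sub_node s j.+1.
Proof.
move=> t01 /sub_setP[a ha ta].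
have a0 : (0 < a)%N.
  rewrite lt0n; apply/eqP => a0; move: (sub_node0 s) ta.
  by rewrite a0 /sub_node => ->; lra.
have am : (a <= sub_size s)%N.
  rewrite leqNgt; apply/negP => ma.
  have {}ma : a = (sub_size s).+1 by lia.
  by move: (sub_node_last s) ta; rewrite ma /sub_node => ->; lra.
by case: a a0 am ta {ha} => // a _ am ->; exists (Ordinal am).
Qed.

Lemma sub_knots_node s (j : 'I_(sub_size s)) : sub_knots s (sub_node s j.+1).
Proof.
split; last exact: sub_node_itv.
by apply: sub_node_set; rewrite ltnS ltnW// ltnS.
Qed.

Lemma sub_knotsP s : knots (sub_knots s).
Proof.
split.
- apply: closedI; last first.
    rewrite (_ : mkset _ = `[0, 1]%classic); first exact: itv_closed.
    by apply/seteqP; split => t /=; rewrite in_itv.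
  by apply: compact_closed; [exact: Rhausdorff|exact/finite_compact/finite_seq].
- by move=> t [].
- have m0 : (0 < sub_size s)%N by rewrite ltnW// sub_size_gt1.
  by have := sub_knots_node (Ordinal m0); rewrite /sub_node /= sub_node1.
- have := sub_size_gt1 s; case E : (sub_size s) => [//|m] _.
  have m1 : (m < sub_size s)%N by rewrite E.
  have := sub_knots_node (Ordinal m1); rewrite /= -E.
  by rewrite (_ : sub_node s (sub_size s) = 1)//; exact: sub_node_size.
Qed.

Lemma hat_node s (j : 'I_(sub_size s)) (b : nat) : (b < (sub_size s).+2)%N ->
  hat (sub_node s j) (sub_node s j.+1) (sub_node s j.+2) (sub_node s b) =
  (b == j.+1)%:R.
Proof.
move=> bm; have jm := ltn_ord j.
have uv : sub_node s j < sub_node s j.+1 by apply: sub_node_lt; lia.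
have vw : sub_node s j.+1 < sub_node s j.+2 by apply: sub_node_lt; lia.
rewrite /hat; case: (ltngtP b j.+1) => [bj|jb|->].
- have bu : sub_node s b <= sub_node s j by apply: sub_node_le; lia.
  case: ifP => [/andP[ub _]|_].
    have -> : sub_node s b = sub_node s j by lra.
    by rewrite subrr mul0r.
  by case: ifP => //; lra.
- have bw : sub_node s j.+2 <= sub_node s b by apply: sub_node_le; lia.
  case: ifP => [|_]; first by lra.
  case: ifP => // /andP[_ wb].
  have -> : sub_node s b = sub_node s j.+2 by lra.
  by rewrite subrr mul0r.
- by rewrite (ltW uv) lexx divff//; lra.
Qed.

Lemma sub_cell s t : 0 <= t <= 1 -> ~ sub_knots s t -> exists a : nat,
  [/\ (0 < a)%N, (a < sub_size s)%N, sub_node s a < t < sub_node s a.+1,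
      lo (sub_knots s) t = sub_node s a & up (sub_knots s) t = sub_node s a.+1].
Proof.
move=> t01 nst; have kS := sub_knotsP s.
have [Fl lt lm] := lo_spec kS t01; have [Fu tu um] := up_spec kS t01.
have [jl El] := sub_set_node (knots_itv kS Fl) Fl.1.
have [ju Eu] := sub_set_node (knots_itv kS Fu) Fu.1.
have {}lt : lo (sub_knots s) t < t.
  by rewrite lt_neqAle lt andbT; apply: contra_notN nst => /eqP <-.
have {}tu : t < up (sub_knots s) t.
  by rewrite lt_neqAle tu andbT; apply: contra_notN nst => /eqP ->.
exists jl.+1; suff E : jl.+2 = ju.+1.
  by rewrite -El E -Eu lt tu; split => //; rewrite -E.
have jlu : (jl < ju)%N.
  rewrite ltnNge; apply/negP => ul; have := ltn_ord jl => ?.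
  have := @sub_node_le s ju.+1 jl.+1 ul; rewrite -El -Eu => h.
  by have := h ltac:(lia); lra.
apply/eqP; rewrite eqn_leq ltnS jlu /= leqNgt; apply/negP => h.
have jum := ltn_ord ju; have h1 : (jl.+1 < sub_size s)%N by lia.
have k1 := sub_knots_node (Ordinal h1); rewrite /= in k1.
have lo1 : sub_node s jl.+1 < sub_node s jl.+2 by apply: sub_node_lt; lia.
have up1 : sub_node s jl.+2 < sub_node s ju.+1 by apply: sub_node_lt; lia.
have [/(lm _ k1)|/ltW/(um _ k1)] := leP (sub_node s jl.+2) t; lra.
Qed.

Lemma pl_hat s (j : 'I_(sub_size s)) t : 0 <= t <= 1 ->
  let phi := hat (sub_node s j) (sub_node s j.+1) (sub_node s j.+2) in
  pl (sub_knots s) phi t = phi t.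
Proof.
move=> t01 phi; have [st|nst] := pselect (sub_knots s t).
  exact: (pl_id _ (sub_knotsP s)).
have [a [a0 am /andP[at' ta'] El Eu]] := sub_cell t01 nst.
rewrite /pl El Eu /phi !hat_node; [|lia..].
have jm := ltn_ord j.
have uv : sub_node s j < sub_node s j.+1 by apply: sub_node_lt; lia.
have vw : sub_node s j.+1 < sub_node s j.+2 by apply: sub_node_lt; lia.
rewrite /line /hat; case: (ltngtP a j.+1) => [aj|ja|E].
- move: aj; rewrite ltnS leq_eqVlt => /predU1P[E|aj].
    rewrite -E in jm uv vw *; rewrite eqxx ifT; last by rewrite (ltW at') ltW.
    by rewrite subr0 mulr1 add0r.
  have tu : sub_node s a.+1 <= sub_node s j by apply: sub_node_le; lia.
  rewrite ltn_eqF// subrr mulr0 addr0 ifF; last by lra.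
  by rewrite ifF//; lra.
- have tu : sub_node s j.+2 <= sub_node s a by apply: sub_node_le; lia.
  rewrite gtn_eqF ?(ltn_trans ja)// subrr mulr0 addr0 ifF; last by lra.
  by rewrite ifF//; lra.
- rewrite -E in jm uv vw *; rewrite gtn_eqF//= ifF; last by lra.
  rewrite ifT; last by rewrite (ltW at') ltW.
  by field; lra.
Qed.

Lemma subdivision_of_seq (l : seq R) : {in l, forall t, 0 <= t <= 1} ->
  exists s : subdivision R, {in l, forall t, sub_set s t} /\
    forall t, sub_knots s t -> [\/ t = 0, t = 1 | t \in l].
Proof.
move=> l01; pose p := sort <=%R (undup (0 :: 1 :: l)).
have memp t : (t \in p) = [|| t == 0, t == 1 | t \in l].
  by rewrite mem_sort mem_undup !inE.
have p01 t : t \in p -> 0 <= t <= 1.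
  rewrite memp => /or3P[/eqP->|/eqP->|/l01//]; by rewrite ?lexx ler01.
have ps : sorted <%R p.
  by rewrite lt_sorted_uniq_le sort_uniq undup_uniq/= sort_le_sorted.
have p0 : p`_0 = 0.
  have mem0 : 0 \in p by rewrite memp eqxx.
  have : 0 <= p`_0 <= 1 by apply/p01/mem_nth; case: (p) mem0.
  case/andP => h _; apply/eqP; rewrite eq_le h andbT.
  rewrite -[leRHS](nth_index 0 mem0).
  apply: (sorted_leq_nth le_trans le_refl) => //; first exact: sort_le_sorted.
    by rewrite inE; case: (p) mem0.
  by rewrite inE index_mem.
have pl1 : p`_(size p).-1 = 1.
  have mem1 : 1 \in p by rewrite memp eqxx orbT.
  have hp : ((size p).-1 < size p)%N by case: (p) mem1.
  have := p01 _ (mem_nth 0 hp).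
  case/andP => _ h; apply/eqP; rewrite eq_le h /=.
  rewrite -[leLHS](nth_index 0 mem1).
  apply: (sorted_leq_nth le_trans le_refl) => //; first exact: sort_le_sorted.
    by rewrite inE index_mem.
  by rewrite -ltnS (ltn_predK hp) index_mem.
have sp : (0 < size p)%N.
  have mem1 : 1 \in p by rewrite memp eqxx orbT.
  by case: (p) mem1.
pose nodes := -1 :: rcons p 2.
have sz : size nodes == (size p).+2 by rewrite /= size_rcons.
have so : sorted <%R nodes.
  rewrite /nodes /=; case Ep : p ps p01 => [|a q]; first by rewrite Ep in sp.
  move=> /= qs p01; have := p01 a (mem_head _ _) => a01.
  rewrite rcons_path qs /=; apply/andP; split; first by lra.
  have := p01 _ (mem_last a q); lra.
have n1 : nodes`_1 = 0 by rewrite /nodes /= nth_rcons sp p0.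
have nm : nodes`_(size p) = 1.
  by rewrite /nodes -(prednK sp) /= nth_rcons prednK// leqnn pl1.
have nl : nodes`_(size p).+1 = 2 by rewrite /nodes /= nth_rcons ltnn eqxx.
exists (@Subdivision R (size p) (Tuple sz) so erefl n1 nm nl); split => [t tl|t].
  rewrite /sub_set /= inE mem_rcons inE memp tl !orbT; exact: isT.
move=> []; rewrite /sub_set /= inE mem_rcons inE memp => + t01.
by move=> /or3P[/eqP|/eqP|/or3P[/eqP|/eqP|]]; (try lra) => h;
  [exact: Or31|exact: Or32|exact: Or33].
Qed.

End SubdivisionKnots.

Section GridInterpolation.
Context {R : realType} {d : nat}.
Implicit Types (S T : 'I_d -> subdivision R) (f g : cube R d -> R).

Definition grid_knots S (i : 'I_d) : set R := sub_knots (S i).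

Lemma grid_knotsP S i : knots (grid_knots S i).
Proof. exact: sub_knotsP. Qed.

Lemma coord_grid_node S (l : lset S) i :
  coord (grid_node l) i = sub_node (S i) (l i).+1.
Proof. exact: coord_mkcube. Qed.

Lemma box_grid S x : box (grid_knots S) x -> exists l : lset S, x = grid_node l.
Proof.
move=> Sx.
have ex i : exists j : 'I_(sub_size (S i)), coord x i = sub_node (S i) j.+1.
  by apply: sub_set_node (coord_itv x i) _; have [] := Sx i.
exists [ffun i => projT1 (cid (ex i))]; apply: cube_ext => i.
by rewrite coord_grid_node ffunE; exact: projT2 (cid (ex i)).
Qed.

Lemma basis_fun_node S (l l' : lset S) : basis_fun l (grid_node l') = (l' == l)%:R.
Proof.
rewrite /basis_fun; under eq_bigr => i _.
  rewrite coord_grid_node hat_node; last by have := ltn_ord (l' i); lia.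
  over.
case: eqP => [->|ne]; first by rewrite big1// => i _; rewrite eqxx.
have [i li] : exists i, l' i != l i.
  apply/existsP; rewrite -negb_forall; apply/negP => /forallP h; apply: ne.
  by apply/ffunP => i; exact/eqP.
by rewrite (bigD1 i)//= eqSS val_eqE (negbTE li) mul0r.
Qed.

Lemma pli_basis_fun S (l : lset S) i :
  pli (grid_knots S) i (basis_fun l) = basis_fun l.
Proof.
apply/funext => x.
pose phi := hat (sub_node (S i) (l i)) (sub_node (S i) (l i).+1)
  (sub_node (S i) (l i).+2).
pose c : R := \prod_(j < d | j != i) hat (sub_node (S j) (l j))
  (sub_node (S j) (l j).+1) (sub_node (S j) (l j).+2) (coord x j).
rewrite [RHS](_ : _ = c * phi (coord x i)); last first.
  by rewrite /basis_fun (bigD1 i)//= mulrC.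
have x01 := coord_itv x i.
have : pl (sub_knots (S i)) phi (coord x i) = phi (coord x i) := pl_hat (l i) x01.
move=> <-; rewrite /pli.
rewrite (@pl_eq_on _ _ _ (fun a => c * phi a + 0) _ (grid_knotsP S i))//.
  by rewrite pl_linear /grid_knots [X in _ + X](_ : _ = 0) ?addr0// /pl /line; ring.
move=> a Sa; have a01 := knots_itv (grid_knotsP S i) Sa.
rewrite addr0 /basis_fun (bigD1 i)//= coord_upd// eqxx mulrC; congr (_ * _).
by apply: eq_bigr => j ji; rewrite coord_upd_ne.
Qed.

Lemma pl_sum (I : finType) (F : set R) (c : I -> R) (phi : I -> R -> R) t :
  pl F (fun a => \sum_l c l * phi l a) t = \sum_l c l * pl F (phi l) t.
Proof.
rewrite /pl /line -sumrB mulr_sumr -big_split/=.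
by apply: eq_bigr => l _; ring.
Qed.

(** Both sides are fixed by the one-dimensional interpolations and agree on the
    grid. *)
Lemma sub_projE S f : sub_proj S f = pla (grid_knots S) f.
Proof.
have <- : pla (grid_knots S) (sub_proj S f) = pla (grid_knots S) f.
  apply: pla_eq_box => [i|x /box_grid[l ->]]; first exact: grid_knotsP.
  rewrite /sub_proj (bigD1 l)//= basis_fun_node eqxx mulr1 big1 ?addr0//.
  by move=> l' ll'; rewrite basis_fun_node eq_sym (negbTE ll') mulr0.
symmetry; apply: pls_id => i _; apply/funext => x.
rewrite /pli /sub_proj pl_sum; apply: eq_bigr => l _.
by congr (_ * _); rewrite -[in RHS](pli_basis_fun l i).
Qed.

Definition grid_values S f : coef_space S :=
  \col_a f (grid_node (enum_val a)).

Lemma interp_grid_values S f : interp (grid_values S f) = sub_proj S f.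
Proof.
apply/funext => x; rewrite /interp /sub_proj.
under eq_bigr => a _ do rewrite mxE.
by rewrite [RHS](reindex _ (onW_bij _ (enum_val_bij (lset S)))).
Qed.

Lemma grid_values_interp S (alpha : coef_space S) :
  grid_values S (interp alpha) = alpha.
Proof.
apply/colP => a; rewrite mxE /interp (bigD1 a)//= basis_fun_node eqxx mulr1.
rewrite big1 ?addr0// => b ba.
by rewrite basis_fun_node (inj_eq enum_val_inj) eq_sym (negbTE ba) mulr0.
Qed.

Lemma pla_interp S (alpha : coef_space S) :
  pla (grid_knots S) (interp alpha) = interp alpha.
Proof. by rewrite -sub_projE -interp_grid_values grid_values_interp. Qed.

End GridInterpolation.

(** * The limit of a nested sequence of subdivisions *)

Section LimitFactor.
Context {R : realType} {d : nat} (S : nat -> 'I_d -> subdivision R) (m0 : nat).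
Hypothesis nested :
  forall m i, (m0 <= m)%N -> sub_set (S m i) `<=` sub_set (S m.+1 i).
Local Notation F := (limit_factor S m0).

Lemma sub_set_nested m m' i : (m0 <= m)%N -> (m <= m')%N ->
  sub_set (S m i) `<=` sub_set (S m' i).
Proof.
move=> m0m; elim: m' => [|m' IH]; first by rewrite leqn0 => /eqP ->.
rewrite leq_eqVlt => /predU1P[->//|mm'] t /(IH mm'); apply: nested.
exact: leq_trans m0m mm'.
Qed.

Lemma grid_knots_nested m m' i : (m0 <= m)%N -> (m <= m')%N ->
  grid_knots (S m) i `<=` grid_knots (S m') i.
Proof. by move=> m0m mm' t [/(sub_set_nested m0m mm')]. Qed.

Lemma grid_knots_limit m i : (m0 <= m)%N -> grid_knots (S m) i `<=` F i.
Proof.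
move=> m0m t [St t01]; split; first by rewrite /= in_itv.
by apply: subset_closure; exists m.
Qed.

Lemma limit_factor_knots i : knots (F i).
Proof.
split.
- by apply: closedI; [exact: itv_closed|exact: closed_closure].
- by move=> t []; rewrite /= in_itv.
- by apply: (@grid_knots_limit m0) => //; exact: (knots0 (grid_knotsP _ _)).
- by apply: (@grid_knots_limit m0) => //; exact: (knots1 (grid_knotsP _ _)).
Qed.

(** By compactness finitely many of the subdivisions, hence a single one, come
    close to every point of the limit set. *)
Lemma grid_knots_dense1 i (eta : R) : 0 < eta -> exists N, forall m,
  (m0 <= m)%N -> (N <= m)%N -> forall p, F i p ->
  exists2 r, grid_knots (S m) i r & `|r - p| <= eta.
Proof.
move=> eta0.
wlog eta1 : eta eta0 / eta < 1 => [hw|].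
  have [|/=|N hN] := hw (Num.min eta 2^-1).
  - by rewrite lt_min eta0 invr_gt0 ltr0n.
  - by rewrite gt_min invf_lt1 ?ltr1n ?orbT.
  exists N => m m0m Nm p /(hN m m0m Nm)[r Sr rp]; exists r => //.
  by apply: (le_trans rp); rewrite ge_min lexx.
have cF : compact (F i).
  apply: (subclosed_compact _ (@segment_compact R 0 1)) => [|t []//].
  exact: knots_closed (limit_factor_knots i).
pose f m : set R := \bigcup_(r in sub_set (S m i)) ball r eta.
rewrite compact_cover in cF.
have [||D D0 FD] := cF nat [set m | (m0 <= m)%N] f.
- move=> m _; apply: bigcup_open => r _; exact: ball_open.
- move=> p [_ /(_ (ball p eta) (nbhsx_ballx _ _ eta0))[r [[m m0m Sr] pr]]].
  by exists m => //; exists r => //; exact: ball_sym.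
exists (\max_(m <- finmap.enum_fset D) m)%N => m m0m Nm p Fp.
have [n /= nD [r Sr rp]] := FD _ Fp.
have m0n : (m0 <= n)%N by have := D0 _ nD; rewrite inE.
exists r; last by rewrite ltW//; exact: rp.
have nm : (n <= m)%N by apply: leq_trans Nm; exact: leq_bigmax_seq.
split; first exact: sub_set_nested Sr.
have [+ _] := Fp; rewrite /= in_itv/= => p01.
have [a am ra] := sub_setP Sr.
move: rp; rewrite /ball /= ltr_norml => rp.
apply/andP; split.
  rewrite leNgt; apply/negP => r0.
  have a0 : a = 0%N.
    apply/eqP; rewrite eqn0Ngt; apply/negP => a0.
    by have := @sub_node_le _ (S n i) 1 a a0 am; rewrite -ra {1}/sub_node sub_node1; lra.
  by move: ra; rewrite a0 /sub_node sub_node0; lra.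
rewrite leNgt; apply/negP => r1.
have a0 : a = (sub_size (S n i)).+1.
  apply/eqP; rewrite eqn_leq -ltnS am/= ltnNge; apply/negP => aM.
  have := @sub_node_le _ (S n i) a (sub_size (S n i)) aM (ltnW (leqnn _)).
  by rewrite -ra /sub_node sub_node_size; lra.
by move: ra; rewrite a0 /sub_node sub_node_last; lra.
Qed.

Lemma grid_knots_dense (eta : R) : 0 < eta -> exists N, forall m,
  (m0 <= m)%N -> (N <= m)%N -> forall i p, F i p ->
  exists2 r, grid_knots (S m) i r & `|r - p| <= eta.
Proof.
move=> eta0.
pose N i := projT1 (cid (grid_knots_dense1 i eta0)).
exists (\max_i N i)%N => m m0m Nm i; apply: (projT2 (cid (grid_knots_dense1 i eta0))) => //.
exact: leq_trans (leq_bigmax i) Nm.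
Qed.

End LimitFactor.

(** * Elements of minimal norm in convex sets *)

Section MinimalNorm.
Context {R : realType} (V : completeNormedModType R).
Implicit Types (E : set V) (u v w : V).

(** The only property of a Hilbert norm used to compare elements of minimal
    norm. *)
Hypothesis parallelogram : forall u v,
  `|u + v| ^+ 2 + `|u - v| ^+ 2 = `|u| ^+ 2 *+ 2 + `|v| ^+ 2 *+ 2.

Definition convex E := forall u v (t : R), E u -> E v -> 0 <= t <= 1 ->
  E ((1 - t) *: u + t *: v).

(** Closedness for the norm, in a form that passes directly to the preimage of a
    set closed for uniform convergence. *)
Definition approx_closed E := forall u,
  (forall e : R, 0 < e -> exists2 v, E v & `|v - u| <= e) -> E u.

Local Notation min_norm E := (argmin E (fun v : V => `|v|)).

(** The midpoint of [u] and [v] belongs to [E]. *)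
Lemma convex_gap E u v (rho : R) : convex E -> 0 <= rho ->
  (forall w, E w -> rho <= `|w|) -> E u -> E v ->
  `|u - v| ^+ 2 <= `|u| ^+ 2 *+ 2 + `|v| ^+ 2 *+ 2 - rho ^+ 2 *+ 4.
Proof.
move=> cE r0 rE Eu Ev.
have /rE : E ((1 - 2^-1) *: u + 2^-1 *: v) by apply: cE => //; lra.
have -> : (1 - 2^-1) *: u + 2^-1 *: v = 2^-1 *: (u + v).
  by rewrite scalerDr; congr (_ *: _ + _); lra.
rewrite normrZ ger0_norm ?invr_ge0// -parallelogram => h.
have {}h : (rho * 2) ^+ 2 <= `|u + v| ^+ 2.
  by rewrite ler_pXn2r ?nnegrE ?mulr_ge0//; lra.
by move: h; rewrite exprMn; lra.
Qed.

Lemma convex_interp (I : Type) E (L : V -> I -> R) (y : I -> R) :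
  (forall (a : R) u v i, L (a *: u + v) i = a * L u i + L v i) ->
  convex E -> convex (E `&` [set h | forall i, L h i = y i]).
Proof.
move=> Llin cE u v t [Eu Lu] [Ev Lv] t01; split; first exact: cE.
move=> i; have L0 : L 0 i = 0.
  by have := Llin 1 0 0 i; rewrite scale1r addr0 mul1r; lra.
by rewrite Llin -[t *: v]addr0 Llin L0 Lu Lv; ring.
Qed.

Lemma cauchy_limit (x : nat -> V) :
  (forall e : R, 0 < e -> exists N, forall m m', (N <= m)%N -> (m <= m')%N ->
     `|x m - x m'| <= e) ->
  exists l, forall e : R, 0 < e -> exists N, forall m, (N <= m)%N ->
     `|x m - l| <= e.
Proof.
move=> cx; have : cvg (x @ \oo).
  apply: cauchy_cvg; apply: cauchy_exP => e e0.
  have [|N hN] := cx (e / 2); first by rewrite divr_gt0.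
  exists (x N); exists N => // m /= Nm; rewrite -ball_normE/=.
  by apply: (le_lt_trans (hN N m (leqnn _) Nm)); lra.
move=> xl; exists (lim (x @ \oo)) => e e0.
have /cvgrPdist_le/(_ e e0)[N _ hN] := xl.
by exists N => m Nm; rewrite distrC; exact: hN.
Qed.

Lemma min_norm_unique E u v : convex E -> min_norm E u -> min_norm E v -> u = v.
Proof.
move=> cE [Eu mu] [Ev mv]; have := convex_gap cE (normr_ge0 u) mu Eu Ev.
have -> : `|v| = `|u| by apply/eqP; rewrite eq_le mu// mv.
rewrite [X in _ <= X](_ : _ = 0) => [h|]; last by lra.
apply/eqP; rewrite -subr_eq0 -normr_eq0 -sqrf_eq0 eq_le h.
by rewrite exprn_ge0.
Qed.

Lemma ler_of_sqr (x y B : R) : 0 <= x -> 0 < y -> x ^+ 2 <= B -> B <= y ^+ 2 ->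
  x <= y.
Proof.
move=> x0 y0 xB By; rewrite -(@ler_pXn2r _ 2)// ?nnegrE//; last exact: ltW.
exact: le_trans xB By.
Qed.

(** A minimizing sequence is Cauchy by [convex_gap]. *)
Lemma min_norm_exists E : convex E -> approx_closed E -> E !=set0 ->
  exists u, min_norm E u.
Proof.
move=> cE clE [u0 Eu0]; pose A := [set `|u| | u in E].
have A0 : A !=set0 by exists `|u0|; exists u0.
have lA : has_lbound A by exists 0 => _ [u _ <-].
pose rho := inf A.
have rE u : E u -> rho <= `|u| by move=> Eu; apply: ge_inf => //; exists u.
have r0 : 0 <= rho by apply: lb_le_inf => // _ [u _ <-].
have ex m : exists u, E u /\ `|u| <= rho + m.+1%:R^-1.
  have m0 : (0 : R) < m.+1%:R^-1 by rewrite invr_gt0.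
  have [_ [u Eu <-] /ltW ur] := inf_adherent m0 (conj A0 lA).
  by exists u.
pose x m := projT1 (cid (ex m)).
have xP m : E (x m) /\ `|x m| <= rho + m.+1%:R^-1 := projT2 (cid (ex m)).
have [e e0|l xl] := @cauchy_limit x.
  pose c := e ^+ 2 / (8 * (rho + 1)).
  have c0 : 0 < c by rewrite divr_gt0 ?exprn_gt0// mulr_gt0//; lra.
  pose a := Num.min 1 c; have a0 : 0 < a by rewrite lt_min ltr01 c0.
  have a1 : a <= 1 by rewrite ge_min lexx.
  have ac : a * (8 * (rho + 1)) <= e ^+ 2.
    by rewrite -ler_pdivlMr ?ge_min ?lexx ?orbT// mulr_gt0//; lra.
  have [N _ hN] := near_infty_natSinv_lt (PosNum a0).
  exists N => m m' Nm mm'.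
  have hm : m.+1%:R^-1 < a := hN m Nm.
  have hm' : m'.+1%:R^-1 < a := hN m' (leq_trans Nm mm').
  have [Em xm] := xP m; have [Em' xm'] := xP m'.
  apply: (ler_of_sqr _ e0 (convex_gap cE r0 rE Em Em')) => //.
  have b1 : `|x m| <= rho + a by apply: (le_trans xm); rewrite lerD2l ltW.
  have b2 : `|x m'| <= rho + a by apply: (le_trans xm'); rewrite lerD2l ltW.
  have sq u : `|u| <= rho + a -> `|u| ^+ 2 <= (rho + a) ^+ 2.
    by move=> ?; rewrite ler_pXn2r ?nnegrE//; lra.
  by have := sq _ b1; have := sq _ b2; nra.
have El : E l.
  apply: clE => e e0; have [N hN] := xl e e0.
  by exists (x N); [have [] := xP N|exact: hN].
exists l; split => // w /rE; apply: le_trans; apply/ler_addgt0Pr => e e0.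
have [|N hN] := xl (e / 2); first by rewrite divr_gt0.
have e20 : 0 < e / 2 by rewrite divr_gt0.
have [M _ hM] := near_infty_natSinv_lt (PosNum e20).
have h1 := hN _ (leq_maxl N M); have [_ h2] := xP (maxn N M).
have h3 : (maxn N M).+1%:R^-1 < e / 2 := hM _ (leq_maxr N M).
have {h3}h2 : `|x (maxn N M)| <= rho + e / 2.
  by apply: (le_trans h2); rewrite lerD2l ltW.
have : `|l| <= `|x (maxn N M)| + `|x (maxn N M) - l|.
  by rewrite -{1}(subKr (x (maxn N M)) l) ler_normB.
lra.
Qed.

End MinimalNorm.

(** * Convergence of minimal-norm elements under perturbed constraints *)

Section PerturbedConstraints.
Context {R : realType} (V : completeNormedModType R) {n : nat}.

Lemma unitmx_inj (A : 'M[R]_n) :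
  (forall c : 'cV_n, A *m c = 0 -> c = 0) -> A \in unitmx.
Proof.
move=> injA; rewrite -unitmx_tr -row_free_unit -kermx_eq0.
apply/rowV0P => v /sub_kermxP vA; apply: trmx_inj; rewrite trmx0; apply: injA.
by rewrite -[A]trmxK -trmx_mul vA trmx0.
Qed.

(** A vector [c] differs from [A c] by at most half of its size, whence both the
    injectivity of [A] and the bound on its inverse. *)
Lemma near_identity_solve (A : 'M[R]_n) (th : R) :
  (forall i j, `|A i j - (i == j)%:R| <= th) -> n%:R * th <= 2^-1 ->
  forall b : 'I_n -> R, exists c : 'cV[R]_n,
    (forall i, \sum_j A i j * c j 0 = b i) /\
    \sum_j `|c j 0| <= (\sum_i `|b i|) *+ 2.
Proof.
move=> Ath nth.
have key (c : 'cV[R]_n) : \sum_j `|c j 0| <= (\sum_i `|(A *m c) i 0|) *+ 2.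
  set s := \sum_j _.
  have s0 : 0 <= s by apply: sumr_ge0.
  suff : s <= \sum_i `|(A *m c) i 0| + n%:R * th * s by nra.
  have -> : n%:R * th * s = \sum_(i < n) th * s.
    by rewrite sumr_const card_ord -mulrA mulr_natl.
  rewrite -big_split; apply: ler_sum => i _ /=.
  have -> : c i 0 = (A *m c) i 0 - \sum_j (A i j - (i == j)%:R) * c j 0.
    rewrite mxE -sumrB (bigD1 i)//= eqxx big1 ?addr0 /=; first by ring.
    by move=> j ji; rewrite eq_sym (negbTE ji) /=; ring.
  apply: (le_trans (ler_normB _ _)); rewrite lerD2l.
  apply: (le_trans (ler_norm_sum _ _ _)); rewrite mulr_sumr.
  by apply: ler_sum => j _; rewrite normrM ler_wpM2r.
have Au : A \in unitmx.
  apply: unitmx_inj => c Ac0; have := key c.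
  rewrite Ac0 [X in _ <= X *+ 2]big1 ?mul0rn; last by move=> i _; rewrite mxE normr0.
  move=> s0; apply/colP => j; rewrite mxE; apply/eqP; rewrite -normr_eq0.
  rewrite eq_le normr_ge0 andbT; apply: le_trans s0.
  by rewrite (bigD1 j)//= lerDl sumr_ge0.
move=> b; exists (invmx A *m \col_i b i).
have E i : (A *m (invmx A *m \col_i b i)) i 0 = b i.
  by rewrite mulmxA mulmxV// mul1mx mxE.
split=> [i|]; first by rewrite -E [RHS]mxE.
by apply: (le_trans (key _)); rewrite ler_pMn2r//; apply: ler_sum => i _; rewrite E.
Qed.

Hypothesis parallelogram : forall u v : V,
  `|u + v| ^+ 2 + `|u - v| ^+ 2 = `|u| ^+ 2 *+ 2 + `|v| ^+ 2 *+ 2.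

Variables (y : 'I_n -> R) (C : nat -> set V) (Cinf : set V).
Variables (L : nat -> V -> 'I_n -> R) (Linf : V -> 'I_n -> R) (m0 : nat).

Local Notation E m := (C m `&` [set h | forall i, L m h i = y i]).
Local Notation Einf := (Cinf `&` [set h | forall i, Linf h i = y i]).
Local Notation min_norm E := (argmin E (fun v : V => `|v|)).

Hypothesis C_convex : forall m, (m0 <= m)%N -> convex (C m).
Hypothesis C_closed : forall m, (m0 <= m)%N -> approx_closed (C m).
Hypothesis C_decr : forall m m', (m0 <= m)%N -> (m <= m')%N -> C m' `<=` C m.
Hypothesis CinfP : forall h, Cinf h <-> forall m, (m0 <= m)%N -> C m h.
Hypothesis L_linear : forall m (a : R) u v i, L m (a *: u + v) i = a * L m u i + L m v i.
Hypothesis Linf_linear : forall (a : R) u v i,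
  Linf (a *: u + v) i = a * Linf u i + Linf v i.
Hypothesis L_cvg : forall dl : R, 0 < dl -> exists N, forall m, (m0 <= m)%N ->
  (N <= m)%N -> forall h i, `|L m h i - Linf h i| <= dl * `|h|.
Variable c : R.
Hypothesis Linf_bounded : forall h i, `|Linf h i| <= c * `|h|.
Variables (z : V) (r : R) (w : 'I_n -> V).
Hypothesis r_gt0 : 0 < r.
Hypothesis z_interior : forall h, `|h - z| <= r -> Cinf h.
Hypothesis z_interp : forall i, Linf z i = y i.
Hypothesis w_dual : forall i j, Linf (w j) i = (i == j)%:R.

Lemma L_sum m (a : 'I_n -> R) i :
  L m (\sum_j a j *: w j) i = \sum_j a j * L m (w j) i.
Proof.
have L0 : L m 0 i = 0.
  have := L_linear m 1 0 0 i; rewrite scale1r addr0 mul1r => h; lra.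
elim/big_rec2 : _ => // j t u _ <-; by rewrite L_linear.
Qed.

(** The matrix of [L m] on the family dual to [Linf] tends to the identity. *)
Lemma L_surjective : exists2 k : R, 0 < k & exists N, forall m, (m0 <= m)%N ->
  (N <= m)%N -> forall (b : 'I_n -> R) (e : R), 0 <= e -> (forall i, `|b i| <= e) ->
  exists v, (forall i, L m v i = b i) /\ `|v| <= k * e.
Proof.
pose W := \sum_j `|w j|.
have W0 : 0 <= W by apply: sumr_ge0.
have wW j : `|w j| <= W by rewrite /W (bigD1 j)//= lerDl sumr_ge0.
have n0 : (0 : R) <= n%:R by [].
exists (W * n%:R *+ 2 + 1); first by rewrite ltr_wpDl// mulrn_wge0// mulr_ge0.
have q0 : 0 < (n%:R + 1) * (W + 1) * 2 by rewrite !mulr_gt0//; lra.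
have [|N hN] := @L_cvg (((n%:R + 1) * (W + 1) * 2)^-1); first by rewrite invr_gt0.
exists N => m m0m Nm b e e0 be.
pose A : 'M[R]_n := \matrix_(i, j) L m (w j) i.
have [i j|| a [Aa ab]] := @near_identity_solve A (((n%:R + 1) * (W + 1) * 2)^-1 * W) _ _ b.
- rewrite mxE -w_dual; apply: (le_trans (hN m m0m Nm _ _)).
  by rewrite ler_wpM2l// invr_ge0 ltW.
- by rewrite mulrCA mulrC ler_pdivrMr//; nra.
exists (\sum_j a j 0 *: w j); split => [i|].
  by rewrite L_sum -Aa; apply: eq_bigr => j _; rewrite mxE mulrC.
apply: (le_trans (ler_norm_sum _ _ _)).
apply: (@le_trans _ _ (\sum_j `|a j 0| * W)).
  by apply: ler_sum => j _; rewrite normrZ ler_wpM2l.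
rewrite -mulr_suml.
have sb : \sum_i `|b i| <= n%:R * e.
  apply: (@le_trans _ _ (\sum_(i < n) e)); first by apply: ler_sum => i _.
  by rewrite sumr_const card_ord mulr_natl.
apply: (@le_trans _ _ (n%:R * e *+ 2 * W)).
  by rewrite ler_wpM2r//; apply: (le_trans ab); rewrite lerMn2r sb.
have -> : (W * n%:R *+ 2 + 1) * e = n%:R * e *+ 2 * W + e by ring.
by rewrite lerDl.
Qed.

(** Moving slightly towards the interior point [z] leaves room, inside [C m], for
    a correction of the interpolation error. *)
Lemma correction (B eps : R) : 0 <= B -> 0 < eps ->
  exists2 sg : R, 0 < sg & exists N, forall m, (m0 <= m)%N -> (N <= m)%N ->
  forall g, C m g -> `|g| <= B -> (forall i, `|L m g i - y i| <= sg) ->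
  exists2 e, E m e & `|e - g| <= eps.
Proof.
move=> B0 eps0; have [k k0 [N1 surj]] := L_surjective.
(* [t] is the weight of the move: [`|z| + r + B] bounds its full length *)
have den0 : 0 < `|z| + r + B + eps by have := normr_ge0 z; have := r_gt0; lra.
have [t [t0 t1 tE]] : exists t, [/\ 0 < t, t <= 1 & t * (`|z| + r + B + eps) = eps].
  exists (eps / (`|z| + r + B + eps)); split; first by rewrite divr_gt0.
    by rewrite ler_pdivrMr//; have := normr_ge0 z; have := r_gt0; lra.
  by rewrite divfK ?gt_eqF.
have z0 := normr_ge0 z; have r0 := r_gt0.
(* [z + v], with [v] of norm at most [r], must compensate the error [sg] of [g]
   divided by [t], and the error of [z]; each gets half of the budget [r / k] *)
pose sg := t * r / (2 * k); exists sg; first by apply: divr_gt0; apply: mulr_gt0.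
pose dl := r / (2 * k * (`|z| + 1)).
have dl0 : 0 < dl by rewrite divr_gt0// !mulr_gt0//; lra.
have dlz : dl * `|z| <= r / (2 * k).
  rewrite /dl invfM mulrA -[leRHS]mulr1 -mulrA ler_wpM2l//.
    by rewrite divr_ge0 ?mulr_ge0// ltW.
  by rewrite mulrC ler_pdivrMr; lra.
have [N2 hN2] := L_cvg dl0.
exists (maxn N1 N2) => m m0m; rewrite geq_max => /andP[N1m N2m] g Cg gB gsg.
have zdl i : `|L m z i - y i| <= r / (2 * k).
  by rewrite -z_interp; apply: le_trans dlz; exact: hN2.
pose b i := - ((1 - t) * (L m g i - y i) + t * (L m z i - y i)) / t.
have [|i|v [Lv vr]] := surj m m0m N1m b (r / k).
- by rewrite divr_ge0// ltW.
- rewrite /b normrM normrN normfV (gtr0_norm t0) ler_pdivrMr//.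
  have rk0 : 0 <= r / (2 * k) by rewrite divr_ge0 ?mulr_ge0// ltW.
  have -> : r / k * t = sg + t * (r / (2 * k)) by rewrite /sg; field; lra.
  apply: (le_trans (ler_normD _ _)); rewrite !normrM (gtr0_norm t0).
  rewrite (ger0_norm (_ : 0 <= 1 - t)) ?subr_ge0//.
  apply: lerD; last by rewrite ler_wpM2l// ltW.
  by apply: le_trans (gsg i); rewrite ler_piMl//; lra.
have {}vr : `|v| <= r by move: vr; rewrite mulrC divfK ?gt_eqF.
have zvC : C m (z + v).
  by apply: (CinfP _).1 => //; apply: z_interior; rewrite addrAC subrr add0r.
exists ((1 - t) *: g + t *: (z + v)).
  split; first by apply: C_convex => //; rewrite (ltW t0).
  move=> i; have L0 : L m 0 i = 0.
    by have := L_linear m 1 0 0 i; rewrite scale1r addr0 mul1r; lra.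
  have LZ a u : L m (a *: u) i = a * L m u i.
    by rewrite -[a *: u]addr0 L_linear L0 addr0.
  have LD u u' : L m (u + u') i = L m u i + L m u' i.
    by rewrite -[u]scale1r L_linear mul1r scale1r.
  by rewrite LD !LZ LD Lv /b; field; lra.
have -> : (1 - t) *: g + t *: (z + v) - g = t *: (z + v - g).
  rewrite scalerBl scale1r [t *: (_ - g)]scalerBr addrAC.
  by rewrite [g - _ - g]addrAC subrr add0r addrC.
rewrite normrZ (gtr0_norm t0) -tE ler_wpM2l ?(ltW t0)//.
apply: (le_trans (ler_normB _ _)); have := ler_normD z v; lra.
Qed.

Variables (x : nat -> V) (xinf : V).
Hypothesis x_min : forall m, (m0 <= m)%N -> min_norm (E m) (x m).
Hypothesis xinf_min : min_norm Einf xinf.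

Lemma norm_x_le (eps : R) : 0 < eps -> exists N, forall m, (m0 <= m)%N ->
  (N <= m)%N -> `|x m| <= `|xinf| + eps.
Proof.
move=> eps0; have [Einfx _] := xinf_min.
have [sg sg0 [N1 hN1]] := correction (normr_ge0 xinf) eps0.
have [|N2 hN2] := @L_cvg (sg / (`|xinf| + 1)); first by rewrite divr_gt0// ltr_wpDl.
exists (maxn N1 N2) => m m0m; rewrite geq_max => /andP[N1m N2m].
have [|||e Ee ex] := hN1 m m0m N1m xinf => //.
- exact: (CinfP _).1 Einfx.1 _ m0m.
- move=> i; rewrite -(Einfx.2 i); apply: (le_trans (hN2 m m0m N2m _ _)).
  by rewrite mulrAC ler_pdivrMr ?ltr_wpDl// ler_wpM2l ?lerDl// ltW.
have [_ /(_ e Ee) /= xe] := x_min m0m; apply: (le_trans xe).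
have : `|e| <= `|xinf| + `|e - xinf| by rewrite -{1}(subrK xinf e) addrC ler_normD.
lra.
Qed.

Let B := `|xinf| + 1.

Lemma norm_x_bounded : exists N, forall m, (m0 <= m)%N -> (N <= m)%N -> `|x m| <= B.
Proof. exact: norm_x_le. Qed.

(** A later minimizer lies in [C m] by monotonicity, and misses the [m]-th
    interpolation conditions by little since the [L m] converge. *)
Lemma x_later_close (eps : R) : 0 < eps -> exists N, forall m m', (m0 <= m)%N ->
  (N <= m)%N -> (m <= m')%N -> exists2 e, E m e & `|e - x m'| <= eps.
Proof.
move=> eps0; have B0 : 0 <= B by rewrite /B addr_ge0.
have [sg sg0 [N1 hN1]] := correction B0 eps0.
have [N3 hN3] := norm_x_bounded.
have B10 : 0 < 2 * (B + 1) by rewrite mulr_gt0//; lra.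
have [|N2 hN2] := @L_cvg (sg / (2 * (B + 1))); first by rewrite divr_gt0.
exists (maxn N1 (maxn N2 N3)) => m m' m0m; rewrite !geq_max.
move=> /and3P[N1m N2m N3m] mm'; have m0m' := leq_trans m0m mm'.
have xB := hN3 m' m0m' (leq_trans N3m mm').
have [[Cx Lx] _] := x_min m0m'.
apply: (hN1 m m0m N1m) => //; first exact: C_decr mm' _ Cx.
move=> i; have h1 := hN2 m m0m N2m (x m') i.
have h2 := hN2 m' m0m' (leq_trans N2m mm') (x m') i.
have h3 : sg / (2 * (B + 1)) * `|x m'| <= sg / 2.
  rewrite invfM mulrA -mulrA ler_piMr//; first by rewrite divr_ge0// ltW.
  by rewrite mulrC ler_pdivrMr; lra.
move: h1 h2; rewrite -(Lx i) !ler_norml; lra.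
Qed.

(** The norms of the minimizers are bounded, and almost nondecreasing by
    [x_later_close]. *)
Lemma norm_x_cauchy (eps : R) : 0 < eps -> exists N, forall m m', (m0 <= m)%N ->
  (N <= m)%N -> (m <= m')%N -> `|x m'| <= `|x m| + eps.
Proof.
move=> eps0; have e20 : 0 < eps / 2 by rewrite divr_gt0.
have [N1 hN1] := x_later_close e20; have [N2 hN2] := norm_x_bounded.
pose N := maxn m0 (maxn N1 N2).
pose A := [set `|x m| | m in [set m | (N <= m)%N]].
have leN m : (N <= m)%N -> [/\ (m0 <= m)%N, (N1 <= m)%N & (N2 <= m)%N].
  by rewrite /N !geq_max => /and3P[].
have hA : has_sup A.
  split; first by exists `|x N|; exists N => //=.
  by exists B => _ [m /= /leN[m0m _ N2m] <-]; exact: hN2.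
have [_ [M /= NM <-] supM] := sup_adherent e20 hA.
exists M => m m' m0m Mm mm'.
have [m0M N1M _] := leN _ NM.
have [e Ee ex] := hN1 M m m0M N1M Mm.
have [_ /(_ e Ee) /= xe] := x_min m0M.
have : `|e| <= `|x m| + `|e - x m| by rewrite -{1}(subrK (x m) e) addrC ler_normD.
have : `|x m'| <= sup A.
  apply: sup_upper_bound => //; exists m' => //=.
  exact: leq_trans NM (leq_trans Mm mm').
lra.
Qed.

Lemma E_convex m : (m0 <= m)%N -> convex (E m).
Proof. by move=> m0m; apply: convex_interp; [exact: L_linear|exact: C_convex]. Qed.

Lemma Einf_convex : convex Einf.
Proof.
apply: convex_interp => [|u v t Cu Cv t01]; first exact: Linf_linear.
by apply/CinfP => m m0m; apply: C_convex => //; exact: (CinfP _).1.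
Qed.

(** The feasible point close to [x m'] has almost the minimal norm in [E m], so
    that [convex_gap] brings it close to [x m]. *)
Lemma x_cauchy (eps : R) : 0 < eps -> exists N, forall m m', (m0 <= m)%N ->
  (N <= m)%N -> (m <= m')%N -> `|x m - x m'| <= eps.
Proof.
move=> eps0; have B0 : 0 <= B by rewrite /B addr_ge0.
pose q := (eps / 2) ^+ 2 / (8 * (B + 1)).
have q0 : 0 < q by rewrite divr_gt0// ?exprn_gt0 ?mulr_gt0 ?divr_gt0//; lra.
pose a := Num.min (Num.min 1 (eps / 2)) q.
have a0 : 0 < a by rewrite !lt_min ltr01 divr_gt0.
have a1 : a <= 1 by rewrite !ge_min lexx.
have ae : a <= eps / 2 by rewrite !ge_min lexx orbT.
have aq : a * (8 * (B + 1)) <= (eps / 2) ^+ 2.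
  by rewrite -ler_pdivlMr ?ge_min ?lexx ?orbT// mulr_gt0//; lra.
have [N1 hN1] := x_later_close a0; have [N2 hN2] := norm_x_cauchy a0.
have [N3 hN3] := norm_x_bounded.
exists (maxn N1 (maxn N2 N3)) => m m' m0m; rewrite !geq_max.
move=> /and3P[N1m N2m N3m] mm'.
have [e Ee ex] := hN1 m m' m0m N1m mm'.
have nx := hN2 m m' m0m N2m mm'; have xB := hN3 m m0m N3m.
have ne : `|e| <= `|x m'| + `|e - x m'|.
  by rewrite -{1}(subrK (x m') e) addrC ler_normD.
have [Ex xmin] := x_min m0m.
have gap := convex_gap parallelogram (E_convex m0m) (normr_ge0 _) xmin Ex Ee.
have e2 : `|e| ^+ 2 <= (`|x m| + a *+ 2) ^+ 2.
  by have h0 := normr_ge0 (x m); rewrite ler_pXn2r ?nnegrE//; lra.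
have h : `|x m - e| <= eps / 2.
  apply: (ler_of_sqr _ _ gap) => //; first by rewrite divr_gt0.
  apply: le_trans aq; have := normr_ge0 (x m); nra.
have : `|x m - x m'| <= `|x m - e| + `|e - x m'|.
  by rewrite -{1}(subrK e (x m)) -addrA ler_normD.
lra.
Qed.

(** The Cauchy argument replaces the usual extraction of a weak limit. *)
Theorem min_norm_cvg (eps : R) : 0 < eps -> exists N, forall m, (m0 <= m)%N ->
  (N <= m)%N -> `|x m - xinf| <= eps.
Proof.
have [e e0|l xl] := @cauchy_limit _ V (fun m => x (m + m0)%N).
  have [N hN] := x_cauchy e0; exists N => m m' Nm mm'; apply: hN.
  - exact: leq_addl.
  - exact: leq_trans Nm (leq_addr _ _).
  - by rewrite leq_add2r.
have {}xl (e : R) : 0 < e -> exists N, forall m, (m0 <= m)%N -> (N <= m)%N ->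
    `|x m - l| <= e.
  move=> /xl[N hN]; exists (N + m0)%N => m m0m Nm.
  by rewrite -(subnK m0m); apply: hN; rewrite leq_subRL// addnC.
suff -> : xinf = l by exact: xl.
(* [l] satisfies the limit constraints and its norm is at most that of [xinf] *)
have Cl : Cinf l.
  apply/CinfP => m m0m; apply: C_closed => // e e0; have [N hN] := xl e e0.
  have mM : (m <= maxn m N)%N by exact: leq_maxl.
  exists (x (maxn m N)); last by apply: hN; rewrite ?leq_maxr// (leq_trans m0m).
  by apply: (C_decr m0m mM); have [[]] := x_min (leq_trans m0m mM).
have c0 : 0 <= `|c| by [].
have Ll i : Linf l i = y i.
  apply/eqP; rewrite -subr_eq0 -normr_le0; apply/ler_addgt0Pl => e e0.
  have e1 : 0 < e / 2 / (`|c| + 1) by rewrite !divr_gt0//; lra.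
  have e2 : 0 < e / 2 / (B + 1) by rewrite !divr_gt0// /B; have := normr_ge0 xinf; lra.
  have [N1 hN1] := xl _ e1; have [N2 hN2] := L_cvg e2.
  have [N3 hN3] := norm_x_bounded.
  pose m := maxn m0 (maxn N1 (maxn N2 N3)).
  have : (m <= m)%N by []; rewrite {1}/m !geq_max => /and4P[m0m N1m N2m N3m].
  have [[_ Lx] _] := x_min m0m.
  have h1 := hN2 m m0m N2m (x m) i; rewrite Lx in h1.
  have h2 := Linf_bounded (x m - l) i.
  have LB : Linf (x m - l) i = Linf (x m) i - Linf l i.
    by rewrite addrC -scaleN1r Linf_linear; ring.
  rewrite LB in h2.
  have h3 : c * `|x m - l| <= e / 2.
    have := hN1 m m0m N1m; rewrite ler_pdivlMr; last by lra.
    apply: le_trans; have s0 := normr_ge0 (x m - l).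
    apply: (le_trans (ler_wpM2r s0 (ler_norm c))).
    by rewrite mulrC ler_wpM2l// lerDl.
  have h4 : e / 2 / (B + 1) * `|x m| <= e / 2.
    have := hN3 m m0m N3m => xB.
    rewrite mulrAC ler_pdivrMr; last by have := normr_ge0 xinf; rewrite /B; lra.
    by rewrite ler_wpM2l//; lra.
  rewrite addr0; move: h1 h2; rewrite !ler_norml; lra.
apply: (min_norm_unique parallelogram Einf_convex xinf_min).
split=> // u Eu; have [_ /(_ u Eu)] := xinf_min; apply: le_trans.
apply/ler_addgt0Pr => e e0; have e20 : 0 < e / 2 by rewrite divr_gt0.
have [N1 hN1] := xl _ e20; have [N2 hN2] := norm_x_le e20.
pose m := maxn m0 (maxn N1 N2).
have : (m <= m)%N by []; rewrite {1}/m !geq_max => /and3P[m0m N1m N2m].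
have h1 := hN1 m m0m N1m; have h2 := hN2 m m0m N2m.
have : `|l| <= `|x m| + `|x m - l| by rewrite -{1}(subKr (x m) l) ler_normB.
lra.
Qed.

End PerturbedConstraints.

(** * Reproducing kernel Hilbert spaces *)

Section RKHS.
Context {R : realType} {T : Type} {K : T -> T -> R} (H : rkhs K).
Implicit Types (u v h : H) (x y : T).

Local Notation dot := (rkhs_dot H).
Local Notation ev := (rkhs_fun H).
Local Notation sec := (rkhs_section H).

Lemma rkhs_dotC u v : dot u v = dot v u.
Proof. by rewrite hermC expr0 mul1r. Qed.

Lemma rkhs_normD u v : `|u + v| ^+ 2 = `|u| ^+ 2 + dot u v *+ 2 + `|v| ^+ 2.
Proof.
rewrite !rkhs_norm_dot linearDl /= !linearDr /= (rkhs_dotC v u) mulr2n.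
by rewrite !addrA.
Qed.

Lemma rkhs_parallelogram u v :
  `|u + v| ^+ 2 + `|u - v| ^+ 2 = `|u| ^+ 2 *+ 2 + `|v| ^+ 2 *+ 2.
Proof. rewrite !rkhs_normD normrN linearNr /=; ring. Qed.

(** Cauchy-Schwarz, from the squared norm of [`|v| *: u - `|u| *: v]. *)
Lemma rkhs_dot_le u v : dot u v <= `|u| * `|v|.
Proof.
have [->|u0] := eqVneq u 0; first by rewrite linear0l normr0 mul0r.
have [->|v0] := eqVneq v 0; first by rewrite linear0r normr0 mulr0.
have a0 : 0 < `|u| by rewrite normr_gt0.
have b0 : 0 < `|v| by rewrite normr_gt0.
have : 0 <= `|(`|v| *: u) + (- `|u|) *: v| ^+ 2 by rewrite exprn_ge0.
rewrite rkhs_normD !normrZ linearZl_LR linearZr /= normrN !normr_id.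
move: (dot u v) => p h.
have ab0 : 0 < `|u| * `|v| by rewrite mulr_gt0.
have : 0 <= (`|u| * `|v|) * (`|u| * `|v| - p).
  by move: h; rewrite !exprMn; nra.
by rewrite pmulr_rge0// subr_ge0.
Qed.

Lemma rkhs_dot_norm u v : `|dot u v| <= `|u| * `|v|.
Proof.
rewrite ler_norml rkhs_dot_le andbT lerNl -(linearNl (dot : H -> H -> R) v u)/=.
by rewrite -[`|u|]normrN rkhs_dot_le.
Qed.

Lemma rkhs_ev_dist h x y : `|ev h x - ev h y| <= `|h| * `|sec x - sec y|.
Proof. by rewrite !rkhs_reproducing -linearBr rkhs_dot_norm. Qed.

Lemma rkhs_ev_norm h x : `|ev h x| <= `|h| * `|sec x|.
Proof. by rewrite rkhs_reproducing rkhs_dot_norm. Qed.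

Lemma rkhs_ev_lin (a : R) u v x : ev (a *: u + v) x = a * ev u x + ev v x.
Proof. by rewrite linearP. Qed.

Lemma rkhs_evZ (a : R) u x : ev (a *: u) x = a * ev u x.
Proof. by rewrite linearZ. Qed.

Lemma rkhs_evB u v x : ev (u - v) x = ev u x - ev v x.
Proof. by rewrite linearB. Qed.

Lemma rkhs_kernel_dot x y : K x y = dot (sec x) (sec y).
Proof. by rewrite -rkhs_reproducing rkhs_sectionE. Qed.

Lemma rkhs_kernelC x y : K x y = K y x.
Proof. by rewrite !rkhs_kernel_dot rkhs_dotC. Qed.

Lemma rkhs_section_dist x y :
  `|sec x - sec y| ^+ 2 = K x x - K x y *+ 2 + K y y.
Proof.
rewrite rkhs_normD normrN linearNr /= !rkhs_norm_dot !rkhs_kernel_dot; ring.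
Qed.

End RKHS.

Section KernelContinuity.
Context {R : realType} {d : nat}.

(** The cube is the image of a compact set of row vectors by clamping. *)
Lemma cube_compact : compact [set: cube R d].
Proof.
have ptP (v : 'rV[R]_d) i : 0 <= clamp (v ord0 i) <= 1 by exact: clamp_itv.
pose p (v : 'rV[R]_d) : cube R d := mkcube (ptP v).
have cp : continuous p.
  move=> v A /nbhs_ballP[e /= e0 eA]; apply/nbhs_ballP; exists e => //.
  move=> v' [_ vv']; apply/eA/cube_ballP => // i.
  rewrite !coord_mkcube; apply: le_lt_trans (clamp_dist _ _) _.
  by have := vv' ord0 i.
have cc : compact (cube R d).
  rewrite (_ : cube R d = [set v | forall i, `[0, 1]%classic (v ord0 i)]).
    by apply: (@rV_compact R d (fun=> `[0, 1]%classic)) => i; exact: segment_compact.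
  apply/seteqP; split => v /= h i; have := h i; by rewrite in_itv.
rewrite (_ : setT = p @` cube R d).
  by apply: continuous_compact => //; apply: continuous_subspaceT.
apply/seteqP; split => // x _; exists (val x); first exact: (set_mem (valP x)).
by apply: cube_ext => i; rewrite coord_mkcube clamp_id//; exact: coord_itv.
Qed.

Context {D : nat} (kD : cube R D -> cube R D -> R).
Hypothesis kD_continuous : continuous (fun p : cube R D * cube R D => kD p.1 p.2).
Local Notation k := (padded_kernel kD : cube R d -> cube R d -> R).

Lemma pad_near (x y : cube R d) (e : R) : 0 < e ->
  (forall i, `|coord x i - coord y i| < e) -> ball (pad x : cube R D) e (pad y).
Proof.
move=> e0 xy; apply/cube_ballP => // j; rewrite !coord_mkcube /pad_coord.
by case: insubP => [i _ _|_]; [exact: xy|rewrite subrr normr0].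
Qed.

Lemma kernel_near (x : cube R d) (e : R) : 0 < e -> exists2 dl : R, 0 < dl &
  forall y y', (forall i, `|coord x i - coord y i| < dl) ->
    (forall i, `|coord x i - coord y' i| < dl) -> `|k x x - k y y'| < e.
Proof.
move=> e0; have /cvgrPdist_lt/(_ e e0) := @kD_continuous (pad x, pad x).
move=> [[U V] [/= /nbhs_ballP[a /= a0 aU] /nbhs_ballP[b /= b0 bV]] UV].
exists (Num.min a b) => [|y y' xy xy']; first by rewrite lt_min a0.
apply: (UV (pad y, pad y')); split => /=.
  by apply: aU; apply: pad_near => // i; have := xy i; rewrite lt_min => /andP[].
by apply: bV; apply: pad_near => // i; have := xy' i; rewrite lt_min => /andP[].
Qed.

Variable H : rkhs k.
Local Notation sec := (rkhs_section H).

Lemma section_near (x : cube R d) (e : R) : 0 < e -> exists2 dl : R, 0 < dl &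
  forall y, (forall i, `|coord x i - coord y i| < dl) -> `|sec x - sec y| < e.
Proof.
move=> e0; have [|dl dl0 hdl] := @kernel_near x (e ^+ 2 / 3).
  by rewrite divr_gt0// exprn_gt0.
exists dl => // y xy; have xx i : `|coord x i - coord x i| < dl by rewrite subrr normr0.
have h1 := hdl _ _ xx xy; have h2 := hdl _ _ xy xy.
rewrite -(@ltr_pXn2r _ 2)// ?nnegrE//; last exact: ltW.
rewrite rkhs_section_dist.
move: h1 h2; rewrite !ltr_norml; lra.
Qed.

Lemma section_unif (e : R) : 0 < e -> exists2 dl : R, 0 < dl &
  forall x y, (forall i, `|coord x i - coord y i| < dl) -> `|sec x - sec y| <= e.
Proof.
move=> e0.
pose P (dl : R) (x : cube R d) :=
  forall y, (forall i, `|coord x i - coord y i| < dl) -> `|sec x - sec y| <= e.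
have /compact_near_coveringP/(_ R (0^'+) P _) := cube_compact.
have cov : forall x : cube R d, [set: cube R d] x -> \forall x' \near x & dl \near 0^'+, P dl x'.
  move=> x _; have [|a a0 ha] := @section_near x (e / 2); first by rewrite divr_gt0.
  have a20 : 0 < a / 2 by rewrite divr_gt0.
  exists (ball x (a / 2), [set dl | dl < a / 2]).
    by split; [exact: nbhsx_ballx|exact: nbhs_right_lt].
  move=> [x' dl] /= [/(cube_ballP x x' a20) xx' dla] y x'y.
  have h1 : `|sec x - sec x'| < e / 2.
    by apply: ha => i; apply: (lt_trans (xx' i)); lra.
  have h2 : `|sec x - sec y| < e / 2.
    apply: ha => i; have := ler_distD (coord x' i) (coord x i) (coord y i).
    by have := xx' i; have := x'y i; lra.
  have := ler_distD (sec x) (sec x') (sec y); rewrite (distrC (sec x') (sec x)); lra.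
move=> /(_ cov) h; near (0 : R)^'+ => dl.
exists dl; first by near: dl; exact: nbhs_right_gt.
by move=> x y; have := near h dl; apply => //.
Unshelve. all: by end_near.
Qed.

Lemma section_bounded : exists2 M : R, 0 < M & forall x, `|sec x| <= M.
Proof.
pose P (M : R) (x : cube R d) := `|sec x| <= M.
have /compact_near_coveringP/(_ R (+oo)%R P _) := cube_compact.
have cov : forall x : cube R d, [set: cube R d] x -> \forall x' \near x & M \near +oo, P M x'.
  move=> x _; have [a a0 ha] := @section_near x 1 ltr01.
  exists (ball x a, [set M | `|sec x| + 1 <= M]).
    by split; [exact: nbhsx_ballx|exact: nbhs_pinfty_ge].
  move=> [x' M] /= [/(cube_ballP x x' a0) /ha xx' xM]; rewrite /P.
  have := ler_distD (sec x) (sec x') 0; rewrite !subr0 (distrC (sec x') (sec x)); lra.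
move=> /(_ cov) h; near (pinfty_nbhs R) => M.
exists M; first by near: M; exact: nbhs_pinfty_gt.
by move=> x; have := near h M; apply => //.
Unshelve. all: by end_near.
Qed.

(** The slope is needed only for points at distance at least [dl], where it has to
    exceed the oscillation, at most [2 M `|h|]. *)
Lemma rkhs_coarse (e : R) : 0 < e -> exists2 K : R, 0 <= K &
  forall h : H, coarse_lip (e * `|h|) (K * `|h|) (rkhs_fun H h).
Proof.
move=> e0; have [dl dl0 hdl] := section_unif e0; have [M M0 hM] := section_bounded.
have K0 : 0 <= M *+ 2 / dl by rewrite divr_ge0 ?mulrn_wge0 ?ltW.
exists (M *+ 2 / dl) => // h x y; apply: (le_trans (rkhs_ev_dist h x y)).
rewrite [leLHS]mulrC mulrAC -mulrDl ler_wpM2r//.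
have d0 : 0 <= dist1 x y by apply: sumr_ge0.
have [near_xy|/existsNP[i /negP far]] :=
    pselect (forall i, `|coord x i - coord y i| < dl).
  by apply: (le_trans (hdl _ _ near_xy)); rewrite lerDl mulr_ge0.
apply: (@le_trans _ _ (M *+ 2)).
  by apply: (le_trans (ler_normB _ _)); rewrite mulr2n lerD.
rewrite -[leLHS](@divfK _ dl) ?gt_eqF//.
apply: (@le_trans _ _ (M *+ 2 / dl * dist1 x y)); last by rewrite lerDr ltW.
rewrite ler_wpM2l//; apply: (@le_trans _ _ `|coord x i - coord y i|).
  by rewrite leNgt.
by rewrite /dist1 (bigD1 i)//= lerDl sumr_ge0.
Qed.

Lemma rkhs_coarse_lips (h : H) : coarse_lips (rkhs_fun H h).
Proof.
move=> e e0; have h0 := normr_ge0 h.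
have [|K K0 lK] := @rkhs_coarse (e / (`|h| + 1)); first by rewrite divr_gt0; lra.
exists (K * `|h|); first by rewrite mulr_ge0.
move=> x y; apply: (le_trans (lK h x y)); rewrite lerD2r.
by rewrite mulrAC ler_pdivrMr ?ler_wpM2l ?ltW//; lra.
Qed.

End KernelContinuity.

(** * Minimal-norm interpolation on a grid *)

Section GramInterpolation.
Context {R : realType} {d : nat} {k : cube R d -> cube R d -> R} (H : rkhs k).
Variable T : 'I_d -> subdivision R.
Hypothesis gramT : gram k T \in unitmx.
Local Notation ev := (rkhs_fun H).
Local Notation node a := (grid_node (enum_val a : lset T)).

Definition gram_coef (alpha : coef_space T) : 'cV[R]_#|{: lset T}| :=
  invmx (gram k T) *m alpha.

Definition gram_interp (alpha : coef_space T) : H :=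
  \sum_a gram_coef alpha a 0 *: rkhs_section H (node a).

Lemma gram_interpE alpha a : ev (gram_interp alpha) (node a) = alpha a 0.
Proof.
have -> : alpha a 0 = (gram k T *m gram_coef alpha) a 0.
  by rewrite mulmxA mulmxV// mul1mx.
rewrite mxE /gram_interp linear_sum fct_sumE; apply: eq_bigr => b _.
by rewrite rkhs_evZ rkhs_sectionE [gram _ _ _ _]mxE (rkhs_kernelC H) mulrC.
Qed.

Lemma gram_interp_dot alpha h :
  rkhs_dot H h (gram_interp alpha) = \sum_a gram_coef alpha a 0 * ev h (node a).
Proof.
rewrite linear_sumr; apply: eq_bigr => a _.
by rewrite linearZr /= rkhs_reproducing.
Qed.

Lemma gram_interp_norm alpha : `|gram_interp alpha| ^+ 2 =
  (alpha^T *m invmx (gram k T) *m alpha) 0 0.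
Proof.
rewrite rkhs_norm_dot gram_interp_dot -mulmxA [RHS]mxE.
by apply: eq_bigr => a _; rewrite gram_interpE [alpha^T _ _]mxE mulrC.
Qed.

(** The difference vanishes on the grid, hence is orthogonal to the sections
    spanning the interpolant. *)
Lemma gram_interp_min alpha h : grid_values T (ev h) = alpha ->
  `|gram_interp alpha| <= `|h|.
Proof.
move=> halpha; pose g := h - gram_interp alpha.
have go : rkhs_dot H g (gram_interp alpha) = 0.
  rewrite gram_interp_dot big1// => a _.
  have ha : alpha a 0 = ev h (node a) by rewrite -halpha mxE.
  by rewrite /g rkhs_evB gram_interpE// ha subrr mulr0.
rewrite -(@ler_pXn2r _ 2)// ?nnegrE// -[h in leRHS](subrK (gram_interp alpha)).
by rewrite rkhs_normD go mul0rn addr0 lerDr exprn_ge0.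
Qed.

Lemma gram_interp_values alpha : grid_values T (ev (gram_interp alpha)) = alpha.
Proof. by apply/colP => a; rewrite mxE gram_interpE. Qed.

End GramInterpolation.

(** * The constraint set and uniform convergence *)

Section UniformTopology.
Context {R : realType}.

Lemma uniform_nbhs_dist (U : choiceType) (f : U -> R) (P : set (U -> R)) :
  nbhs (f : {uniform U -> R}) P ->
  exists2 e : R, 0 < e & forall g, (forall x, `|g x - f x| < e) -> P g.
Proof.
move=> /uniform_nbhs[A []]; rewrite -entourage_ballE => -[e /= e0 eA] AP.
exists e => // g gf; apply: AP => x _; apply: eA => /=.
by rewrite /ball /= distrC.
Qed.

Lemma uniform_cvg_dist (U : choiceType) (f : nat -> U -> R) (g : U -> R) :
  (forall e : R, 0 < e -> exists N, forall m, (N <= m)%N ->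
     forall x, `|f m x - g x| <= e) ->
  {uniform, f @ \oo --> g}.
Proof.
move=> fg P /uniform_nbhs_dist[e e0 eP]; have [|N hN] := fg (e / 2).
  by rewrite divr_gt0.
by exists N => // m /hN h; apply: eP => x; apply: (le_lt_trans (h x)); lra.
Qed.

Context {d D : nat} (dD : (d <= D)%N) (CD : set (cube R D -> R)).

Lemma constraint_set_closed : closed (CD : set {uniform (cube R D) -> R}) ->
  forall f : cube R d -> R,
  (forall e : R, 0 < e -> exists2 g, constraint_set dD CD g &
     forall x, `|g x - f x| <= e) ->
  constraint_set dD CD f.
Proof.
move=> clD f h; apply: clD => P /uniform_nbhs_dist[e e0 eP].
have [|g Cg gf] := h (e / 2); first by rewrite divr_gt0.
exists (g \o head_coords dD); split => //; apply: eP => x /=.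
by apply: (le_lt_trans (gf _)); lra.
Qed.

Lemma constraint_set_convex :
  convex_set (CD : set (convex_lmodType (cube R D -> R^o))) ->
  forall (f g : cube R d -> R) (t : R),
  constraint_set dD CD f -> constraint_set dD CD g -> 0 <= t <= 1 ->
  constraint_set dD CD (fun x => (1 - t) * f x + t * g x).
Proof.
move=> cD f g t Cf Cg t01.
have t01' : 0 <= 1 - t <= 1 by lra.
have := cD (f \o head_coords dD) (g \o head_coords dD) (Itv01 (andP t01').1 (andP t01').2).
rewrite !inE => /(_ Cf Cg).
rewrite /constraint_set /=; congr CD; apply/funext => x.
rewrite /conv /=; rewrite -[unstable.onem _]/(1 - (1 - t)) subKr.
by [].
Qed.

End UniformTopology.

(** * Feasible elements of the Hilbert space *)

Section Feasible.
Context {R : realType} {d n : nat} {k : cube R d -> cube R d -> R} (H : rkhs k).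
Variables (C : set (cube R d -> R)) (X : 'I_n -> cube R d) (y : 'I_n -> R).
Hypothesis C_closed : forall f, (forall e : R, 0 < e -> exists2 g, C g &
  forall x, `|g x - f x| <= e) -> C f.
Hypothesis C_convex : forall f g (t : R), C f -> C g -> 0 <= t <= 1 ->
  C (fun x => (1 - t) * f x + t * g x).
Variable M : R.
Hypothesis M_gt0 : 0 < M.
Hypothesis section_le : forall x, `|rkhs_section H x| <= M.
Local Notation ev := (rkhs_fun H).
Implicit Types (G : 'I_d -> set R) (u v h : H).

Definition rkhs_pla G h : cube R d -> R := pla G (ev h).

(** The modes are stated through coefficients or restrictions, with a quadratic
    form or a quotient norm; both minimize the norm of [H] over a set of this
    form, for the knots of the subdivision or for the limit knots. *)
Definition feasible G : set H :=
  [set h | C (rkhs_pla G h)] `&` [set h | forall i, rkhs_pla G h (X i) = y i].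

Local Notation min_norm E := (argmin E (fun h : H => `|h|)).

Lemma rkhs_pla_lin G (a : R) u v :
  rkhs_pla G (a *: u + v) = fun x => a * rkhs_pla G u x + rkhs_pla G v x.
Proof.
rewrite /rkhs_pla /pla -pls_linear; congr pls; apply/funext => x.
exact: rkhs_ev_lin.
Qed.

Lemma rkhs_pla_dist G u v x : (forall i, knots (G i)) ->
  `|rkhs_pla G u x - rkhs_pla G v x| <= M * `|u - v|.
Proof.
move=> kG; apply: pls_dist => // z; rewrite -rkhs_evB.
by apply: (le_trans (rkhs_ev_norm _ _)); rewrite mulrC ler_wpM2r.
Qed.

Lemma rkhs_pla_convex G : convex [set h | C (rkhs_pla G h)].
Proof.
move=> u v t /= Cu Cv t01; rewrite rkhs_pla_lin.
rewrite (_ : (fun x => _) =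
  fun x => (1 - t) * rkhs_pla G u x + t * rkhs_pla G v x); first exact: C_convex.
apply/funext => x; congr (_ + _).
have P0 : rkhs_pla G 0 x = 0.
  have /funeqP/(_ x) := rkhs_pla_lin G 1 0 0; rewrite scale1r addr0 mul1r; lra.
by rewrite -[t *: v]addr0 rkhs_pla_lin P0 addr0.
Qed.

Lemma rkhs_pla_closed G : (forall i, knots (G i)) ->
  approx_closed [set h | C (rkhs_pla G h)].
Proof.
move=> kG h hC; apply: C_closed => e e0.
have [|g Cg gh] := hC (e / M); first by rewrite divr_gt0.
exists (rkhs_pla G g) => // x; apply: (le_trans (rkhs_pla_dist _ _ _ kG)).
by rewrite mulrC -ler_pdivlMr.
Qed.

Lemma feasible_convex G : convex (feasible G).
Proof.
apply: convex_interp; last exact: rkhs_pla_convex.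
by move=> a u v i; rewrite rkhs_pla_lin.
Qed.

Lemma feasible_closed G : (forall i, knots (G i)) -> approx_closed (feasible G).
Proof.
move=> kG h hE; split.
  by apply: rkhs_pla_closed => // e /hE[g [Cg _] gh]; exists g.
move=> i; apply/eqP; rewrite -subr_eq0 -normr_le0; apply/ler_addgt0Pl => e e0.
have [|g [_ /= gX] gh] := hE (e / M); first by rewrite divr_gt0.
rewrite addr0 -(gX i) distrC; apply: (le_trans (rkhs_pla_dist _ _ _ kG)).
by rewrite mulrC -ler_pdivlMr.
Qed.

Lemma feasible_min_unique G u v :
  min_norm (feasible G) u -> min_norm (feasible G) v -> u = v.
Proof. exact: (min_norm_unique (rkhs_parallelogram (H := H)) (feasible_convex (G := G))). Qed.

(** The quadratic form at [a] is the squared norm of the minimal interpolant of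
    [a], which is feasible when [a] is. *)
Lemma mode_coefs_min (T : 'I_d -> subdivision R) h : gram k T \in unitmx ->
  min_norm (feasible (grid_knots T)) h ->
  mode_coefs k C X y T = [set grid_values T (ev h)].
Proof.
move=> gT [Eh hmin].
have interpE g : interp (grid_values T (ev g)) = rkhs_pla (grid_knots T) g.
  by rewrite interp_grid_values sub_projE.
have quad (a : coef_space T) : `|gram_interp H (T := T) a| ^+ 2 = (a^T *m invmx (gram k T) *m a) 0 0.
  exact: gram_interp_norm.
have leJ (a b : coef_space T) : `|gram_interp H (T := T) a| <= `|gram_interp H (T := T) b| <->
    (a^T *m invmx (gram k T) *m a) 0 0 <= (b^T *m invmx (gram k T) *m b) 0 0.
  by rewrite -!quad ler_pXn2r ?nnegrE.
have feasE (a : coef_space T) : feasible (grid_knots T) (gram_interp H (T := T) a) <->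
    (interpolants X y `&` C) (interp (a : coef_space T)).
  rewrite /feasible /= -interpE gram_interp_values//.
  by split=> -[? ?]; split.
have hle : `|gram_interp H (T := T) (grid_values T (ev h))| <= `|h| by exact: gram_interp_min.
apply/seteqP; split => [a [Ca amin]|_ ->].
  have Cg : (interpolants X y `&` C) (interp (grid_values T (ev h))).
    by rewrite interpE; split; [exact: Eh.2|exact: Eh.1].
  have /leJ ah := amin _ Cg.
  suff <- : gram_interp H (T := T) a = h by rewrite gram_interp_values.
  apply: (@feasible_min_unique (grid_knots T)) => //; split; first exact/feasE.
  by move=> z Ez; apply: (le_trans ah); apply: (le_trans hle); exact: hmin.
split; first by rewrite /= interpE; split; [exact: Eh.2|exact: Eh.1].
by move=> a /feasE/hmin ha; apply/leJ; exact: le_trans hle ha.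
Qed.

Variable F : 'I_d -> set R.
Hypothesis kF : forall i, knots (F i).
Hypothesis ev_lips : forall h, coarse_lips (ev h).

Lemma restr_extE h : multiaffine_ext (restr F (ev h)) = rkhs_pla F h.
Proof. exact: multiaffine_extE. Qed.

Lemma limit_feasibleP h :
  (rkhs_on H F `&` constraint_on F C `&` interpolants_on F X y)
    (restr F (ev h)) <-> feasible F h.
Proof.
have crh : continuous (restr F (ev h)).
  move=> x; apply: continuous_comp; first exact: initial_continuous.
  exact: (coarse_lip_continuous (@ev_lips h)).
rewrite /constraint_on /interpolants_on /interpolants /= restr_extE.
split=> [[[_ [_ Ch]] [_ Xh]]|[Ch Xh]]; first by split.
by split; [split; [exists h|split]|split].
Qed.

(** The infimum defining the norm of a restriction is attained, the fibre being
    closed and convex. *)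
Lemma fiber_min h : exists g, restr F (ev g) = restr F (ev h) /\
  rkhs_on_norm H F (restr F (ev h)) = `|g|.
Proof.
pose E := [set g : H | restr F (ev g) = restr F (ev h)].
have EP g : E g <-> forall x : box F, ev g (val x) = ev h (val x).
  by split=> [/funeqP|Eg]; [exact|apply/funext].
have [|||g [Eg gmin]] := @min_norm_exists _ H (rkhs_parallelogram (H := H)) E.
- move=> u v t /EP Eu /EP Ev t01; apply/EP => x.
  by rewrite rkhs_ev_lin rkhs_evZ Eu Ev; ring.
- move=> u uE; apply/EP => x; apply/eqP; rewrite -subr_eq0 -normr_le0.
  apply/ler_addgt0Pl => e e0; rewrite addr0.
  have [|g /EP Eg gu] := uE (e / M); first by rewrite divr_gt0.
  rewrite -Eg distrC -rkhs_evB; apply: (le_trans (rkhs_ev_norm _ _)).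
  by rewrite mulrC; apply: (@le_trans _ _ (M * `|g - u|));
    [rewrite ler_wpM2r|rewrite mulrC -ler_pdivlMr].
- by exists h.
exists g; split => //; apply/eqP; rewrite eq_le /rkhs_on_norm; apply/andP; split.
  apply: ge_inf; first by exists 0 => _ [u _ <-].
  by exists g.
apply: lb_le_inf; first by exists `|g|, g.
by move=> _ [u Eu <-]; exact: gmin.
Qed.

Lemma limit_modes_min h : min_norm (feasible F) h ->
  limit_modes H F C X y = [set restr F (ev h)].
Proof.
move=> [Eh hmin].
have norm_ge g : feasible F g -> `|h| <= rkhs_on_norm H F (restr F (ev g)).
  move=> /limit_feasibleP Eg; have [g' [gg' ->]] := fiber_min g.
  by apply: hmin; apply/limit_feasibleP; rewrite gg'.
have norm_le g : rkhs_on_norm H F (restr F (ev g)) <= `|g|.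
  apply: ge_inf; first by exists 0 => _ [u _ <-].
  by exists g.
apply/seteqP; split => [f [Ef fmin]|_ ->]; last first.
  split; first exact/limit_feasibleP.
  move=> f Ef; have [[[g _ gf] _] _] := Ef.
  rewrite -gf in Ef *; apply: (le_trans (norm_le h)); apply: norm_ge.
  exact/limit_feasibleP.
have [[[g _ gf] _] _] := Ef; have [g' [gg' ng]] := fiber_min g.
rewrite -gf -gg' /=; congr (restr F (ev _)).
have Eg' : feasible F g' by apply/limit_feasibleP; rewrite gg' gf.
apply: (@feasible_min_unique F) => //; split => // z Ez.
have /fmin : (rkhs_on H F `&` constraint_on F C `&` interpolants_on F X y)
  (restr F (ev h)) by exact/limit_feasibleP.
rewrite -gf ng => /le_trans; apply; apply: (le_trans (norm_le h)); exact: hmin.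
Qed.

End Feasible.

(** * Convergence of the interpolants and of the modes *)

(** Interpolated values at the points [X j] only involve the neighbours in [F] of
    their coordinates, in finite number. These neighbours may be limits of nodes
    without being nodes of any member of the sequence of subdivisions, whence a
    subdivision of their own, to which hypotheses on finitely many values apply. *)
Lemma local_subdivision {R : realType} {d n : nat} (F : 'I_d -> set R)
    (X : 'I_n -> cube R d) : (forall i, knots (F i)) ->
  exists T : 'I_d -> subdivision R, (forall i, grid_knots T i `<=` F i) /\
    forall g j, pla (grid_knots T) g (X j) = pla F g (X j).
Proof.
move=> kF.
pose l i := [seq lo (F i) (coord (X j) i) | j : 'I_n] ++
  [seq up (F i) (coord (X j) i) | j : 'I_n].
have Fl i : {in l i, forall t, F i t}.
  move=> t; rewrite mem_cat => /orP[] /mapP[j _ ->].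
    by have [] := lo_spec (kF i) (coord_itv (X j) i).
  by have [] := up_spec (kF i) (coord_itv (X j) i).
have l01 i : {in l i, forall t, 0 <= t <= 1}.
  by move=> t /Fl; exact: (knots_itv (kF i)).
pose T i := projT1 (cid (subdivision_of_seq (l01 i))).
have TP i : {in l i, forall t, sub_set (T i) t} /\
    forall t, sub_knots (T i) t -> [\/ t = 0, t = 1 | t \in l i].
  exact: projT2 (cid (subdivision_of_seq (l01 i))).
have TF i : grid_knots T i `<=` F i.
  move=> t /(TP i).2[->|->|/Fl//]; [exact: knots0 (kF i)|exact: knots1 (kF i)].
exists T; split => // g j; symmetry; apply: pla_local => // i.
have x01 := coord_itv (X j) i; have kT := grid_knotsP T i.
have [Fl' llt lm] := lo_spec (kF i) x01; have [Fu utu um] := up_spec (kF i) x01.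
have Tl : grid_knots T i (lo (F i) (coord (X j) i)).
  split; last exact: (knots_itv (kF i)).
  by apply: (TP i).1; rewrite mem_cat (fintype.image_f (fun j => lo (F i) (coord (X j) i))).
have Tu : grid_knots T i (up (F i) (coord (X j) i)).
  split; last exact: (knots_itv (kF i)).
  by apply: (TP i).1; rewrite mem_cat orbC (fintype.image_f (fun j => up (F i) (coord (X j) i))).
split; symmetry.
  by apply: lo_eq => // s /TF; exact: lm.
by apply: up_eq => // s /TF; exact: um.
Qed.

Section InterpolantConvergence.
Context {R : realType} {d D : nat} (kD : cube R D -> cube R D -> R).
Hypothesis kD_continuous : continuous (fun p : cube R D * cube R D => kD p.1 p.2).
Variable H : rkhs (padded_kernel kD : cube R d -> cube R d -> R).
Variables (S : nat -> 'I_d -> subdivision R) (m0 : nat).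
Hypothesis nested :
  forall m i, (m0 <= m)%N -> sub_set (S m i) `<=` sub_set (S m.+1 i).
Local Notation F := (limit_factor S m0).

(** Convergence is uniform over balls of [H], by equicontinuity. *)
Lemma rkhs_pla_cvg (dl : R) : 0 < dl -> exists N, forall m, (m0 <= m)%N ->
  (N <= m)%N -> forall (h : H) x,
  `|rkhs_pla (grid_knots (S m)) h x - rkhs_pla F h x| <= dl * `|h|.
Proof.
move=> dl0; have kF := limit_factor_knots S m0.
pose q := size (index_enum 'I_d).
have q0 : (0 : R) <= q%:R by [].
have p0 : (0 : R) < 4 ^+ q by rewrite exprn_gt0.
(* [pls_coarse_lip] loses a factor [4 ^+ q], and [pls_approx] sums [q] errors,
   each shared equally between [e] and the slope term *)
pose e := dl / 2 / (q%:R + 1) / 4 ^+ q.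
have e0 : 0 < e by rewrite !divr_gt0//; lra.
have [K K0 lK] := rkhs_coarse kD_continuous H e0.
pose eta := dl / 4 / (q%:R + 1) / (K + 1).
have eta0 : 0 < eta by rewrite !divr_gt0//; lra.
have [N hN] := grid_knots_dense nested eta0.
exists N => m m0m Nm h x; have h0 := normr_ge0 h.
have kS := grid_knotsP (S m).
have SF i : grid_knots (S m) i `<=` F i by exact: grid_knots_limit.
have eh0 : 0 <= e * `|h| by rewrite mulr_ge0// ltW.
have Kh0 : 0 <= K * `|h| by rewrite mulr_ge0.
have := @pls_approx _ _ F (grid_knots (S m)) (index_enum 'I_d) (rkhs_pla F h)
  (e * `|h| * 4 ^+ q) (K * `|h|) eta kF kS SF.
rewrite -[pls (grid_knots (S m)) _ _]/(pla _ (pla F (rkhs_fun H h))).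
rewrite pla_fine_coarse// => /(_ _ Kh0 _ (hN m m0m Nm) _ x) approx.
apply: le_trans (approx _ _ _) _.
- by rewrite mulr_ge0// ltW.
- exact: pls_coarse_lip.
- by move=> i; exact: pla_fixed.
have -> : e * `|h| * 4 ^+ q = dl / 2 / (q%:R + 1) * `|h|.
  by rewrite /e; field; lra.
have : K * `|h| * (eta *+ 2) <= dl / 2 / (q%:R + 1) * `|h|.
  rewrite -mulrA (mulrC `|h|) mulrA ler_wpM2r//.
  have -> : K * (eta *+ 2) = dl / 2 / (q%:R + 1) * (K / (K + 1)).
    by rewrite /eta; field; lra.
  rewrite ler_piMr//; first by rewrite !divr_ge0 ?ltW//; lra.
  by rewrite ler_pdivrMr; lra.
move=> hK; rewrite -/q -[leLHS]mulr_natr.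
apply: (@le_trans _ _ (dl / 2 / (q%:R + 1) * `|h| *+ 2 * q%:R)).
  by rewrite ler_wpM2r// mulr2n lerD2l.
have -> : dl / 2 / (q%:R + 1) * `|h| *+ 2 * q%:R =
  dl * `|h| * (q%:R / (q%:R + 1)) by field; lra.
by rewrite ler_piMr ?mulr_ge0 ?(ltW dl0)// ler_pdivrMr; lra.
Qed.

End InterpolantConvergence.

Theorem theorem2 (R : realType) (d D n m0 : nat)
  (d_ge1 : (1 <= d)%N) (dD : (d <= D)%N) (n_ge1 : (1 <= n)%N)
  (CD : set (cube R D -> R)) (kD : cube R D -> cube R D -> R)
  (Cdot : set (cube R d -> R))
  (X : 'I_n -> cube R d) (y : 'I_n -> R)
  (S : nat -> 'I_d -> subdivision R)
  (H : rkhs (padded_kernel kD : cube R d -> cube R d -> R)) :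
  let k : cube R d -> cube R d -> R := padded_kernel kD in
  let C := constraint_set dD CD in
  let F := limit_factor S m0 in
  CD `<=` [set f | continuous f] ->
  Cdot `<=` C ->
  continuous_gp_covariance kD ->
  (forall T : 'I_d -> subdivision R, gram k T \in unitmx) ->
  (forall m i, (m0 <= m)%N -> sub_set (S m i) `<=` sub_set (S m.+1 i)) ->
  (* (1) *)
  convex_set (CD : set (convex_lmodType (cube R D -> R^o))) ->
  closed (CD : set {uniform (cube R D) -> R}) ->
  (* (2) *)
  [set alpha : coef_space (S m0) |
    (interpolants X y `&` Cdot) (interp alpha)] !=set0 ->
  (* (3) *)
  [set (fun i => interp alpha (X i)) | alpha in [set: coef_space (S m0)]] =
    [set: 'I_n -> R] ->
  (* (4) *)
  (forall (h : cube R d -> R) (r : nat) (U : 'I_r -> cube R d),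
    Cdot h -> injective U ->
    exists z : H, (interior [set h' : H | C (rkhs_fun H h')]) z /\
      interpolants U (h \o U) (rkhs_fun H z)) ->
  (* (5) *)
  (forall T : 'I_d -> subdivision R, sub_proj T @` C `<=` C) ->
  (* (6) *)
  (forall f, C f -> C (multiaffine_ext (restr F f))) ->
  [/\ forall m, (m0 <= m)%N ->
        mode_coefs k C X y (S m) = [set mode_coef k C X y (S m)],
      limit_modes H F C X y = [set limit_mode H F C X y]
    & {uniform, (fun m => mode_fun k C X y (S m)) @ \oo -->
        multiaffine_ext (limit_mode H F C X y)}].
Proof.
move=> k C F _ CdotC [kDc _] gramU nested CDconv CDclosed.
move=> [alpha0 [alpha0X alpha0C]] surj strict projC _.
have C_closed := @constraint_set_closed _ _ _ dD _ CDclosed.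
have C_convex := @constraint_set_convex _ _ _ dD _ CDconv.
have {}projC (T : 'I_d -> subdivision R) f : C f -> C (pla (grid_knots T) f).
  by move=> Cf; rewrite -sub_projE; apply: projC; exists f.
have kF : forall i, knots (F i) := limit_factor_knots S m0.
have kS m := grid_knotsP (S m).
have SF m i : (m0 <= m)%N -> grid_knots (S m) i `<=` F i.
  exact: grid_knots_limit.
have [M M0 hM] := section_bounded kDc H.
have lips := rkhs_coarse_lips kDc (H := H).
have cvgP := rkhs_pla_cvg kDc H nested.
pose Cm m := [set h : H | C (rkhs_pla (grid_knots (S m)) h)].
pose Cinf := [set h : H | C (rkhs_pla F h)].
have CinfP h : Cinf h <-> forall m, (m0 <= m)%N -> Cm m h.
  split=> [Ch m m0m|Ch].
    rewrite /Cm /= /rkhs_pla -(pla_fine_coarse (F := F)) => [||//|i].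
    - exact: projC.
    - exact: kF.
    - exact: SF.
  apply: C_closed => e e0.
  have [|N hN] := cvgP (e / (`|h| + 1)); first by rewrite divr_gt0// ltr_wpDl.
  exists (rkhs_pla (grid_knots (S (maxn m0 N))) h).
    by apply: Ch; exact: leq_maxl.
  move=> x; apply: (le_trans (hN _ (leq_maxl _ _) (leq_maxr _ _) h x)).
  by rewrite mulrAC ler_pdivrMr ?ltr_wpDl// ler_wpM2l ?lerDl// ltW.
have C_decr m m' : (m0 <= m)%N -> (m <= m')%N -> Cm m' `<=` Cm m.
  move=> m0m mm' h Ch; rewrite /Cm /= /rkhs_pla.
  rewrite -(pla_fine_coarse (F := grid_knots (S m'))) => [|//|//|i].
  - exact: projC.
  - exact: (grid_knots_nested nested m0m mm').
have [T [TF TX]] := local_subdivision X kF.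
have interpF (alpha : coef_space (S m0)) : pla F (interp alpha) = interp alpha.
  by rewrite -pla_interp pla_coarse_refine// => i; exact: SF.
(* values at the nodes of [T] determine the interpolated values at the [X j] *)
have plaT (alpha : coef_space (S m0)) h j :
    grid_values T (rkhs_fun H h) = grid_values T (interp alpha) ->
    rkhs_pla F h (X j) = interp alpha (X j).
  move=> hT; rewrite /rkhs_pla -[in RHS](interpF alpha) -!TX -!sub_projE.
  by rewrite -!interp_grid_values hT.
have node_inj : injective (fun a : 'I_#|{: lset T}| => grid_node (enum_val a : lset T)).
  move=> a b ab; apply: enum_val_inj; apply/eqP.
  have := basis_fun_node (enum_val b : lset T) (enum_val a).
  rewrite ab basis_fun_node eqxx => /esym/eqP.
  by case: (enum_val a == enum_val b) => //; rewrite eq_sym oner_eq0.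
(* the interior point of all the constraint sets *)
have [z [zint zT]] := strict _ _ _ alpha0C node_inj.
have zX i : rkhs_pla F z (X i) = y i.
  rewrite -(alpha0X i); apply: plaT; apply/colP => a; rewrite !mxE; exact: zT.
have [r r0 zr] : exists2 r : R, 0 < r & forall h, `|h - z| <= r -> Cinf h.
  have /nbhs_ballP[r /= r0 rC] := zint.
  exists (r / 2) => [|h hz]; first by rewrite divr_gt0.
  apply/CinfP => m m0m; apply: projC; apply: rC.
  by rewrite -ball_normE /= distrC; apply: (le_lt_trans hz); lra.
(* the dual family, from the surjectivity of evaluation on interpolants *)
have [w wX] : exists w : 'I_n -> H,
    forall i j, rkhs_pla F (w j) (X i) = (i == j)%:R.
  have ex j : exists alpha : coef_space (S m0),
      forall i, interp alpha (X i) = (i == j)%:R.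
    have : [set: 'I_n -> R] (fun i => (i == j)%:R) by [].
    by rewrite -surj => -[alpha _ /funeqP h]; exists alpha.
  exists (fun j => gram_interp H (T := T) (grid_values T (interp (projT1 (cid (ex j)))))).
  move=> i j; rewrite (plaT (projT1 (cid (ex j)))).
    exact: (projT2 (cid (ex j))).
  exact: gram_interp_values.
(* the interpolant given by [alpha0] is its own interpolant on finer grids, so
   that the minimal element with its nodal values is feasible *)
have exm m : (m0 <= m)%N -> exists x,
    argmin (feasible C X y (grid_knots (S m))) (fun h : H => `|h|) x.
  move=> m0m; apply: min_norm_exists.
  - exact: rkhs_parallelogram.
  - exact: feasible_convex.
  - exact: (feasible_closed C_closed M0 hM (kS m)).
  exists (gram_interp H (T := S m) (grid_values (S m) (interp alpha0))).
  have E : rkhs_pla (grid_knots (S m))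
      (gram_interp H (T := S m) (grid_values (S m) (interp alpha0))) = interp alpha0.
    rewrite /rkhs_pla -sub_projE -interp_grid_values gram_interp_values//.
    rewrite interp_grid_values sub_projE -pla_interp pla_coarse_refine// => i; exact: (grid_knots_nested nested (leqnn m0) m0m).
  by split; rewrite /= E; [exact: CdotC|exact: alpha0X].
have [xinf xinfP] : exists x, argmin (feasible C X y F) (fun h : H => `|h|) x.
  apply: min_norm_exists.
  - exact: rkhs_parallelogram.
  - exact: feasible_convex.
  - exact: (feasible_closed C_closed M0 hM kF).
  by exists z; split => //; apply: zr; rewrite subrr normr0 ltW.
pose x m := if @idP (m0 <= m)%N is ReflectT h then projT1 (cid (exm m h)) else 0.
have xP m : (m0 <= m)%N ->
    argmin (feasible C X y (grid_knots (S m))) (fun h : H => `|h|) (x m).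
  by rewrite /x; case: {-}_ / idP => // h _; exact: projT2 (cid (exm m h)).
have modesE m : (m0 <= m)%N -> mode_coefs k C X y (S m) =
    [set grid_values (S m) (rkhs_fun H (x m))].
  move=> m0m; apply: mode_coefs_min => //; exact: xP.
have limE : limit_modes H F C X y = [set restr F (rkhs_fun H xinf)].
  exact: (limit_modes_min C_convex M0 hM kF).
have modeE m : (m0 <= m)%N ->
    mode_coef k C X y (S m) = grid_values (S m) (rkhs_fun H (x m)).
  by move=> m0m; rewrite /mode_coef modesE//; exact: xget_unique.
have limitE : limit_mode H F C X y = restr F (rkhs_fun H xinf).
  by rewrite /limit_mode limE; exact: xget_unique.
split=> [m m0m||]; [by rewrite modeE// modesE|by rewrite limitE|].
apply: uniform_cvg_dist => e e0.
have e20 : 0 < e / 2 / M by rewrite !divr_gt0.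
have [N1 hN1] : exists N, forall m, (m0 <= m)%N -> (N <= m)%N ->
    `|x m - xinf| <= e / 2 / M.
  apply: (@min_norm_cvg _ H _ (rkhs_parallelogram (H := H)) y Cm Cinf
    (fun m h i => rkhs_pla (grid_knots (S m)) h (X i))
    (fun h i => rkhs_pla F h (X i)) m0 _ _ C_decr CinfP _ _ _ M _ z r w) => //.
  - by move=> m m0m; exact: rkhs_pla_convex.
  - by move=> m m0m; exact: (rkhs_pla_closed C_closed M0 hM).
  - by move=> m a u v i; rewrite rkhs_pla_lin.
  - by move=> a u v i; rewrite rkhs_pla_lin.
  - move=> dl dl0; have [N hN] := cvgP _ dl0; exists N => m m0m Nm h i.
    exact: hN.
  - move=> h i; have := rkhs_pla_dist hM h 0 (X i) kF.
    have P0 : rkhs_pla F (0 : H) (X i) = 0.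
      have /funeqP/(_ (X i)) := rkhs_pla_lin F 1 (0 : H) 0.
      rewrite scale1r addr0 mul1r; lra.
    by rewrite P0 !subr0.
have [|N2 hN2] := cvgP (e / 2 / (`|xinf| + 1)).
  by rewrite !divr_gt0// ltr_wpDl.
exists (maxn m0 (maxn N1 N2)) => m; rewrite !geq_max => /and3P[m0m N1m N2m] t.
rewrite limitE (restr_extE kF lips) /mode_fun modeE// interp_grid_values sub_projE.
have h1 : `|rkhs_pla (grid_knots (S m)) (x m) t -
    rkhs_pla (grid_knots (S m)) xinf t| <= e / 2.
  apply: (le_trans (rkhs_pla_dist hM _ _ _ (kS m))).
  by rewrite mulrC -ler_pdivlMr// hN1.
have h2 : `|rkhs_pla (grid_knots (S m)) xinf t - rkhs_pla F xinf t| <= e / 2.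
  apply: (le_trans (hN2 m m0m N2m xinf t)).
  rewrite mulrAC ler_pdivrMr ?ltr_wpDl// ler_wpM2l ?lerDl//.
  by rewrite divr_ge0// ltW.
have := ler_distD (rkhs_pla (grid_knots (S m)) xinf t)
  (rkhs_pla (grid_knots (S m)) (x m) t) (rkhs_pla F xinf t).
rewrite -/(rkhs_pla (grid_knots (S m)) (x m)); lra.
Qed.
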